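(* Let $U\subset\mathbb{R}^2$ be open and let $f(u,v)=(x(u,v),y(u,v),z(u,v))$ be a non-degenerate $d$-minimal immersion $U\to\mathbb{R}^{0,2,1}$ such that $(u,v)$ are isothermal coordinates. Put $w=u+iv$ and $$\varphi_1=x_u-ix_v,\quad \varphi_2=y_u-iy_v,\quad \varphi_3=z_u-iz_v. \qquad(\ast)$$ Then $\varphi_1,\varphi_2,\varphi_3$ are holomorphic in $w$ and satisfy $$|\varphi_1|^2+|\varphi_2|^2>0,\qquad \varphi_1^2+\varphi_2^2=0. \qquad(\ast\ast)$$ Moreover $(f_u,f_u)=(f_v,f_v)=\frac12(|\varphi_1|^2+|\varphi_2|^2)$. Conversely, let $U\subset\mathbb{C}$ be a simply connected domain and $\varphi_1,\varphi_2,\varphi_3$ holomorphic functions on $U$ satisfying $(\ast\ast)$. Then, fixing $w_0\in U$, the map $f(u,v)=\mathrm{Re}\int_{w_0}^{w}(\varphi_1,\varphi_2,\varphi_3)\,dw$ (with $w=u+iv$) is a well-defined non-degenerate $d$-minimal immersion $U\to\mathbb{R}^{0,2,1}$ satisfying $(\ast)$, and $(u,v)$ are isothermal coordinates for it.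
   Context: $\mathbb{R}^{0,2,1}$ denotes $\mathbb{R}^3$ with coordinates $(x,y,z)$ and the degenerate form $(\cdot,\cdot)=dx^2+dy^2$. A non-degenerate immersion is a $C^\infty$ immersion $f$ of a 2-manifold into $\mathbb{R}^{0,2,1}$ whose induced metric $g=f^*(\cdot,\cdot)$ is positive definite. Let $\xi=(0,0,1)$ and let $d$ be the standard flat connection of $\mathbb{R}^3$. Writing $d_X(df(Y))=df(\nabla_XY)+h(X,Y)\xi$, with $\nabla$ the Levi-Civita connection of $g$, defines the second fundamental form $h$. $f$ is $d$-minimal if $\mathrm{tr}_gh\equiv0$. Coordinates $(u,v)$ are isothermal if $(f_u,f_u)=(f_v,f_v)$ and $(f_u,f_v)=0$. *)

(* Defs.v *)
From Stdlib Require Import Reals ClassicalEpsilon.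
Open Scope R_scope.

Definition Cx := (R * R)%type.
Definition Cadd (z w : Cx) : Cx := (fst z + fst w, snd z + snd w).
Definition Csub (z w : Cx) : Cx := (fst z - fst w, snd z - snd w).
Definition Cmul (z w : Cx) : Cx :=
  (fst z * fst w - snd z * snd w, fst z * snd w + snd z * fst w).
Definition Cnorm2 (z : Cx) : R := fst z ^ 2 + snd z ^ 2.

Definition open2 (U : R -> R -> Prop) : Prop :=
  forall u v, U u v -> exists r, 0 < r /\
    forall u' v', (u' - u) ^ 2 + (v' - v) ^ 2 < r ^ 2 -> U u' v'.

(** Partial derivatives (the value of the limit when it exists). *)
Definition pdu (F : R -> R -> R) (u v : R) : R :=
  epsilon (inhabits 0) (fun l => derivable_pt_lim (fun s => F s v) u l).
Definition pdv (F : R -> R -> R) (u v : R) : R :=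
  epsilon (inhabits 0) (fun l => derivable_pt_lim (fun t => F u t) v l).

Definition cont2_on (S : R -> R -> Prop) (F : R -> R -> R) : Prop :=
  forall u v, S u v -> forall eps, 0 < eps -> exists delta, 0 < delta /\
    forall u' v', S u' v' -> (u' - u) ^ 2 + (v' - v) ^ 2 < delta ^ 2 ->
      Rabs (F u' v' - F u v) < eps.

Fixpoint Ck (k : nat) (U : R -> R -> Prop) (F : R -> R -> R) : Prop :=
  cont2_on U F /\
  match k with
  | O => True
  | S k' =>
      (forall u v, U u v ->
         (exists l, derivable_pt_lim (fun s => F s v) u l) /\
         (exists l, derivable_pt_lim (fun t => F u t) v l)) /\
      Ck k' U (pdu F) /\ Ck k' U (pdv F)
  end.

Definition smooth_on (U : R -> R -> Prop) (F : R -> R -> R) : Prop :=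
  forall k, Ck k U F.

Definition D (i : bool) (F : R -> R -> R) : R -> R -> R :=
  if i then pdv F else pdu F.

Definition sumb (F : bool -> R) : R := F false + F true.

(** Induced metric g = f^*(dx^2 + dy^2); components g_ij. *)
Definition gm (x y : R -> R -> R) (i j : bool) : R -> R -> R :=
  fun u v => D i x u v * D j x u v + D i y u v * D j y u v.

Definition detg (x y : R -> R -> R) (u v : R) : R :=
  gm x y false false u v * gm x y true true u v - gm x y false true u v ^ 2.

Definition ginv (x y : R -> R -> R) (i j : bool) (u v : R) : R :=
  (match i, j with
   | false, false => gm x y true true u v
   | true, true => gm x y false false u v
   | _, _ => - gm x y false true u v
   end) / detg x y u v.

Definition Gamma (x y : R -> R -> R) (k i j : bool) (u v : R) : R :=
  / 2 * sumb (fun l => ginv x y k l u v *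
     (D i (gm x y j l) u v + D j (gm x y i l) u v - D l (gm x y i j) u v)).

(** Second fundamental form h_ij: the xi = (0,0,1) component of
    d_{d_i}(df(d_j)) = df(nabla_{d_i} d_j) + h_ij xi, i.e. the z-component. *)
Definition hff (x y z : R -> R -> R) (i j : bool) (u v : R) : R :=
  D i (D j z) u v - sumb (fun k => Gamma x y k i j u v * D k z u v).

Definition trace_h (x y z : R -> R -> R) (u v : R) : R :=
  sumb (fun i => sumb (fun j => ginv x y i j u v * hff x y z i j u v)).

Definition immersion (U : R -> R -> Prop) (x y z : R -> R -> R) : Prop :=
  smooth_on U x /\ smooth_on U y /\ smooth_on U z /\
  forall u v, U u v -> forall a b,
    a * D false x u v + b * D true x u v = 0 ->
    a * D false y u v + b * D true y u v = 0 ->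
    a * D false z u v + b * D true z u v = 0 -> a = 0 /\ b = 0.

Definition nondegenerate_immersion (U : R -> R -> Prop) (x y z : R -> R -> R) : Prop :=
  immersion U x y z /\
  forall u v, U u v -> forall a b, (a, b) <> (0, 0) ->
    0 < a ^ 2 * gm x y false false u v + 2 * a * b * gm x y false true u v
        + b ^ 2 * gm x y true true u v.

Definition d_minimal (U : R -> R -> Prop) (x y z : R -> R -> R) : Prop :=
  forall u v, U u v -> trace_h x y z u v = 0.

Definition isothermal (U : R -> R -> Prop) (x y z : R -> R -> R) : Prop :=
  forall u v, U u v ->
    gm x y false false u v = gm x y true true u v /\ gm x y false true u v = 0.

Definition holomorphic (U : R -> R -> Prop) (phi : R -> R -> Cx) : Prop :=
  forall u v, U u v -> exists c : Cx, forall eps, 0 < eps -> exists delta, 0 < delta /\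
    forall h k, 0 < h ^ 2 + k ^ 2 < delta ^ 2 ->
      Cnorm2 (Csub (Csub (phi (u + h) (v + k)) (phi u v)) (Cmul c (h, k)))
        <= eps ^ 2 * (h ^ 2 + k ^ 2).

Definition cont_on01 (g : R -> R) : Prop :=
  forall t, 0 <= t <= 1 -> forall eps, 0 < eps -> exists delta, 0 < delta /\
    forall s, 0 <= s <= 1 -> Rabs (s - t) < delta -> Rabs (g s - g t) < eps.

Definition path_in (U : R -> R -> Prop) (g : R -> Cx) : Prop :=
  cont_on01 (fun t => fst (g t)) /\ cont_on01 (fun t => snd (g t)) /\
  forall t, 0 <= t <= 1 -> U (fst (g t)) (snd (g t)).

Definition square01 (s t : R) : Prop := 0 <= s <= 1 /\ 0 <= t <= 1.

Definition simply_connected_domain (U : R -> R -> Prop) : Prop :=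
  open2 U /\ (exists u v, U u v) /\
  (forall p q : Cx, U (fst p) (snd p) -> U (fst q) (snd q) ->
     exists g, path_in U g /\ g 0 = p /\ g 1 = q) /\
  (forall g, path_in U g -> g 0 = g 1 ->
     exists H : R -> R -> Cx,
       cont2_on square01 (fun s t => fst (H s t)) /\
       cont2_on square01 (fun s t => snd (H s t)) /\
       (forall s t, square01 s t -> U (fst (H s t)) (snd (H s t))) /\
       (forall s, 0 <= s <= 1 -> H s 0 = g s) /\
       (exists c, forall s, 0 <= s <= 1 -> H s 1 = c) /\
       (forall t, 0 <= t <= 1 -> H 0 t = H 1 t)).

Definition C1path (U : R -> R -> Prop) (g1 g2 g1' g2' : R -> R) : Prop :=
  (forall t, derivable_pt_lim g1 t (g1' t)) /\
  (forall t, derivable_pt_lim g2 t (g2' t)) /\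
  continuity g1' /\ continuity g2' /\
  (forall t, 0 <= t <= 1 -> U (g1 t) (g2 t)).

Definition is_RInt (g : R -> R) (a b I : R) : Prop :=
  exists pr : Riemann_integrable g a b, RiemannInt pr = I.

Definition re_path_integral_is (phi : R -> R -> Cx) (g1 g2 g1' g2' : R -> R) (I : R) : Prop :=
  is_RInt (fun t => fst (Cmul (phi (g1 t) (g2 t)) (g1' t, g2' t))) 0 1 I.

Definition phi_of (F : R -> R -> R) : R -> R -> Cx :=
  fun u v => (pdu F u v, - pdv F u v).

(* Main.v *)
(** A one-form [P du + Q dv] whose coefficients are pointwise differentiable with
    [P_v = Q_u] has vanishing integral over the boundary of every rectangle (Goursat), so it has
    potentials on boxes; one point of mere continuity may be allowed.  Applied to the difference
    quotient of a holomorphic [f] this gives Cauchy's formula on a circle, and differentiating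
    under the integral shows that [f'] is holomorphic, hence that [f] is smooth.

    On a simply connected domain the local potentials of [Re (phi dw)] are glued as follows: the
    integrals over short segments form a local cocycle, its sum over the samples [g (i / N)] of
    a path does not depend on [N] for [N] large, and comparing neighbouring rows of a sampled
    homotopy shows that it vanishes on loops.

    In isothermal coordinates with conformal factor [E] the trace of [h] is [(z_uu + z_vv) / E],
    and isothermality alone makes [x] and [y] harmonic; harmonicity of a function [F] is the
    Cauchy-Riemann system for [F_u - i F_v].  Conversely a potential of [Re (phi dw)] satisfies
    [phi = F_u - i F_v], which gives isothermality, harmonicity and non-degeneracy. *)

From Stdlib Require Import Reals Lra Lia ClassicalEpsilon FunctionalExtensionality
  PropExtensionality.
From Coquelicot Require Import Coquelicot.
Require Import Defs.
Open Scope R_scope.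

(** * Goursat's lemma for real one-forms *)


(** [holomorphic] asserts only that a complex derivative exists at each point, while [immersion]
    asks for derivatives of every order. Green's theorem would need a continuous derivative, so
    closed rectangle integrals have to be obtained by bisection, and smoothness has to come from an
    integral formula. A complex form phi dw is handled as the two real forms Re (phi dw) and Im (phi
    dw).

    The second obstacle is that the paths and homotopies in [simply_connected_domain] are merely
    continuous, so nothing can be integrated along them. What survives is a function of two nearby
    points that is additive inside a box: its sums along samples of a path replace the integral, and
    path independence becomes a combinatorial statement about grids. The C1 paths of the theorem
    enter only at the end, through the fundamental theorem of calculus for a potential already
    found.

    Partial derivatives are chosen by [epsilon], so agreement of functions on an open set has to be
    carried over to their partials by extensionality. *)

Lemma continuity_2d_pt_fst (P : R -> R -> R) (x y : R) :
  continuity_2d_pt P x y -> continuous (fun s => P s y) x.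
Proof.
  intros H. apply filterlim_locally. intros eps. destruct (H eps) as [d Hd].
  exists d. intros s Hs. apply (Hd s y). exact Hs.
  rewrite Rminus_diag, Rabs_R0. apply cond_pos.
Qed.

Lemma continuity_2d_pt_snd (P : R -> R -> R) (x y : R) :
  continuity_2d_pt P x y -> continuous (fun t => P x t) y.
Proof.
  intros H. apply filterlim_locally. intros eps. destruct (H eps) as [d Hd].
  exists d. intros s Hs. apply (Hd x s).
  rewrite Rminus_diag, Rabs_R0. apply cond_pos. exact Hs.
Qed.

Definition rect (x1 x2 y1 y2 u v : R) : Prop := x1 <= u <= x2 /\ y1 <= v <= y2.

Definition cont_at (P Q : R -> R -> R) (u v : R) : Prop :=
  continuity_2d_pt P u v /\ continuity_2d_pt Q u v.

(** The repeated [b] is the closedness condition: the v-derivative of [P] equals the u-derivative of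
    [Q], at one point and without continuity of either. *)
Definition closed_at (P Q : R -> R -> R) (u v : R) : Prop :=
  exists a b c, differentiable_pt_lim P u v a b /\ differentiable_pt_lim Q u v b c.

Lemma closed_at_cont (P Q : R -> R -> R) (u v : R) :
  closed_at P Q u v -> cont_at P Q u v.
Proof.
  intros (a & b & c & HP & HQ). split; apply differentiable_continuity_pt.
  exists a, b; exact HP. exists b, c; exact HQ.
Qed.

(** The counterclockwise boundary integral of P du + Q dv, with opposite sides paired so that only
    differences of [P] and of [Q] across the rectangle occur. *)
Definition rect_int (P Q : R -> R -> R) (x1 x2 y1 y2 : R) : R :=
  RInt (fun s => P s y1 - P s y2) x1 x2 + RInt (fun t => Q x2 t - Q x1 t) y1 y2.

Lemma ex_RInt_horizontal (P Q : R -> R -> R) (x1 x2 y1 y2 y a b : R) :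
  (forall u v, rect x1 x2 y1 y2 u v -> cont_at P Q u v) ->
  x1 <= a <= x2 -> x1 <= b <= x2 -> y1 <= y <= y2 -> ex_RInt (fun s => P s y) a b.
Proof.
  intros H Ha Hb Hy. apply (ex_RInt_continuous (V := R_CompleteNormedModule)).
  intros s Hs. apply continuity_2d_pt_fst. apply H. split; [|exact Hy].
  revert Hs. unfold Rmin, Rmax. destruct (Rle_dec a b); lra.
Qed.

Lemma ex_RInt_vertical (P Q : R -> R -> R) (x1 x2 y1 y2 x a b : R) :
  (forall u v, rect x1 x2 y1 y2 u v -> cont_at P Q u v) ->
  y1 <= a <= y2 -> y1 <= b <= y2 -> x1 <= x <= x2 -> ex_RInt (fun t => Q x t) a b.
Proof.
  intros H Ha Hb Hy. apply (ex_RInt_continuous (V := R_CompleteNormedModule)).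
  intros s Hs. apply continuity_2d_pt_snd. apply H. split; [exact Hy|].
  revert Hs. unfold Rmin, Rmax. destruct (Rle_dec a b); lra.
Qed.

Lemma ex_RInt_Rminus (f g : R -> R) (a b : R) :
  ex_RInt f a b -> ex_RInt g a b -> ex_RInt (fun t => f t - g t) a b.
Proof. intros Hf Hg. exact (ex_RInt_minus (V := R_NormedModule) f g a b Hf Hg). Qed.

Lemma RInt_Rminus (f g : R -> R) (a b : R) :
  ex_RInt f a b -> ex_RInt g a b ->
  RInt (fun t => f t - g t) a b = RInt f a b - RInt g a b.
Proof. intros Hf Hg. exact (RInt_minus (V := R_CompleteNormedModule) f g a b Hf Hg). Qed.

Lemma rect_int_split_x (P Q : R -> R -> R) (x1 x x2 y1 y2 : R) :
  (forall u v, rect x1 x2 y1 y2 u v -> cont_at P Q u v) ->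
  x1 <= x <= x2 -> y1 <= y2 ->
  rect_int P Q x1 x2 y1 y2 = rect_int P Q x1 x y1 y2 + rect_int P Q x x2 y1 y2.
Proof.
  intros H Hx Hy. unfold rect_int.
  assert (EH : forall a b, x1 <= a <= x2 -> x1 <= b <= x2 ->
            ex_RInt (fun s => P s y1 - P s y2) a b).
  { intros a b Ha Hb. apply ex_RInt_Rminus;
    apply (ex_RInt_horizontal P Q x1 x2 y1 y2); auto; lra. }
  assert (EV : forall c, x1 <= c <= x2 -> ex_RInt (fun t => Q c t) y1 y2).
  { intros c Hc. apply (ex_RInt_vertical P Q x1 x2 y1 y2); auto; lra. }
  rewrite <- (RInt_Chasles (V := R_CompleteNormedModule) _ x1 x x2) by (apply EH; lra).
  unfold plus; simpl.
  rewrite (RInt_Rminus (fun t => Q x2 t) (fun t => Q x1 t)),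
    (RInt_Rminus (fun t => Q x t) (fun t => Q x1 t)),
    (RInt_Rminus (fun t => Q x2 t) (fun t => Q x t)) by (apply EV; lra). ring.
Qed.

Lemma rect_int_split_y (P Q : R -> R -> R) (x1 x2 y1 y y2 : R) :
  (forall u v, rect x1 x2 y1 y2 u v -> cont_at P Q u v) ->
  x1 <= x2 -> y1 <= y <= y2 ->
  rect_int P Q x1 x2 y1 y2 = rect_int P Q x1 x2 y1 y + rect_int P Q x1 x2 y y2.
Proof.
  intros H Hx Hy. unfold rect_int.
  assert (EV : forall a b, y1 <= a <= y2 -> y1 <= b <= y2 ->
            ex_RInt (fun t => Q x2 t - Q x1 t) a b).
  { intros a b Ha Hb. apply ex_RInt_Rminus;
    apply (ex_RInt_vertical P Q x1 x2 y1 y2); auto; lra. }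
  assert (EH : forall c, y1 <= c <= y2 -> ex_RInt (fun t => P t c) x1 x2).
  { intros c Hc. apply (ex_RInt_horizontal P Q x1 x2 y1 y2); auto; lra. }
  rewrite <- (RInt_Chasles (V := R_CompleteNormedModule) _ y1 y y2) by (apply EV; lra).
  unfold plus; simpl.
  rewrite (RInt_Rminus (fun s => P s y1) (fun s => P s y2)),
    (RInt_Rminus (fun s => P s y1) (fun s => P s y)),
    (RInt_Rminus (fun s => P s y) (fun s => P s y2)) by (apply EH; lra). ring.
Qed.

Lemma RInt_near_const (f : R -> R) (a b c K : R) :
  a <= b -> ex_RInt f a b -> (forall t, a <= t <= b -> Rabs (f t - c) <= K) ->
  Rabs (RInt f a b - (b - a) * c) <= (b - a) * K.
Proof.
  intros Hab Hf HK.
  replace (RInt f a b - (b - a) * c) with (RInt (fun t => f t - c) a b).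
  - apply abs_RInt_le_const; auto. apply ex_RInt_Rminus; auto. apply ex_RInt_const.
  - rewrite RInt_Rminus; auto using ex_RInt_const. rewrite RInt_const. reflexivity.
Qed.

(** The constant parts [p] and [q] integrate to zero together, which leaves the error [K] times half
    the perimeter. *)
Lemma rect_int_near (P Q : R -> R -> R) (x1 x2 y1 y2 p q K : R) :
  (forall u v, rect x1 x2 y1 y2 u v -> cont_at P Q u v) ->
  x1 <= x2 -> y1 <= y2 ->
  (forall s, x1 <= s <= x2 -> Rabs (P s y1 - P s y2 - p) <= K) ->
  (forall t, y1 <= t <= y2 -> Rabs (Q x2 t - Q x1 t - q) <= K) ->
  (x2 - x1) * p + (y2 - y1) * q = 0 ->
  Rabs (rect_int P Q x1 x2 y1 y2) <= ((x2 - x1) + (y2 - y1)) * K.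
Proof.
  intros H Hx Hy HP HQ E. unfold rect_int.
  assert (E1 := RInt_near_const (fun s => P s y1 - P s y2) x1 x2 p K Hx).
  assert (E2 := RInt_near_const (fun t => Q x2 t - Q x1 t) y1 y2 q K Hy).
  assert (F1 := E1 ltac:(apply ex_RInt_Rminus;
    apply (ex_RInt_horizontal P Q x1 x2 y1 y2); auto; lra) HP).
  assert (F2 := E2 ltac:(apply ex_RInt_Rminus;
    apply (ex_RInt_vertical P Q x1 x2 y1 y2); auto; lra) HQ).
  apply Rabs_le_between in F1. apply Rabs_le_between in F2.
  apply Rabs_le_between. lra.
Qed.

(** Affine approximation at the point: in the paired differences the values and the terms in [a] and
    [c] cancel, and the two [b] terms contribute opposite multiples of the area. The bound is
    quadratic in the half perimeter, so it scales like the area under bisection. *)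
Lemma rect_int_closed_small (P Q : R -> R -> R) (u v eps : R) :
  closed_at P Q u v -> 0 < eps ->
  exists d, 0 < d /\ forall x1 x2 y1 y2,
    (forall u' v', rect x1 x2 y1 y2 u' v' -> cont_at P Q u' v') ->
    rect x1 x2 y1 y2 u v -> x2 - x1 < d -> y2 - y1 < d ->
    Rabs (rect_int P Q x1 x2 y1 y2) <= eps * ((x2 - x1) + (y2 - y1)) ^ 2.
Proof.
  intros (a & b & c & HP & HQ) Heps.
  assert (He : 0 < eps / 2) by lra.
  destruct (HP (mkposreal _ He)) as [d1 H1]. destruct (HQ (mkposreal _ He)) as [d2 H2].
  simpl in H1, H2. assert (P1 := cond_pos d1). assert (P2 := cond_pos d2).
  exists (Rmin d1 d2). split; [now apply Rmin_pos|].
  intros x1 x2 y1 y2 Hc [Hu Hv] Hx Hy.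
  assert (Rmin d1 d2 <= d1) by apply Rmin_l. assert (Rmin d1 d2 <= d2) by apply Rmin_r.
  set (l := (x2 - x1) + (y2 - y1)).
  assert (M : forall s t, rect x1 x2 y1 y2 s t ->
     Rabs (s - u) < Rmin d1 d2 /\ Rabs (t - v) < Rmin d1 d2 /\
     Rmax (Rabs (s - u)) (Rabs (t - v)) <= l).
  { intros s t [Hs Ht]. repeat split.
    - apply Rabs_def1; lra.
    - apply Rabs_def1; lra.
    - apply Rmax_lub; apply Rabs_le; unfold l; lra. }
  assert (B1 : forall s t, rect x1 x2 y1 y2 s t ->
     Rabs (P s t - P u v - (a * (s - u) + b * (t - v))) <= eps / 2 * l).
  { intros s t Hst. destruct (M s t Hst) as (M1 & M2 & M3).
    eapply Rle_trans; [apply H1; lra|]. apply Rmult_le_compat_l; lra. }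
  assert (B2 : forall s t, rect x1 x2 y1 y2 s t ->
     Rabs (Q s t - Q u v - (b * (s - u) + c * (t - v))) <= eps / 2 * l).
  { intros s t Hst. destruct (M s t Hst) as (M1 & M2 & M3).
    eapply Rle_trans; [apply H2; lra|]. apply Rmult_le_compat_l; lra. }
  replace (eps * l ^ 2) with (l * (eps * l)) by ring.
  apply (rect_int_near P Q x1 x2 y1 y2 (b * (y1 - y2)) (b * (x2 - x1))); auto; try lra.
  - intros s Hs.
    assert (A1 := B1 s y1 ltac:(split; lra)). assert (A2 := B1 s y2 ltac:(split; lra)).
    apply Rabs_le_between in A1. apply Rabs_le_between in A2. apply Rabs_le_between. lra.
  - intros t Ht.
    assert (A1 := B2 x1 t ltac:(split; lra)). assert (A2 := B2 x2 t ltac:(split; lra)).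
    apply Rabs_le_between in A1. apply Rabs_le_between in A2. apply Rabs_le_between. lra.
Qed.

Lemma rect_int_quarter (P Q : R -> R -> R) (x y l m K : R) :
  0 <= l -> 0 <= m ->
  (forall u v, rect x (x + 2 * l) y (y + 2 * m) u v -> cont_at P Q u v) ->
  4 * K <= Rabs (rect_int P Q x (x + 2 * l) y (y + 2 * m)) ->
  exists x' y', (x' = x \/ x' = x + l) /\ (y' = y \/ y' = y + m) /\
    K <= Rabs (rect_int P Q x' (x' + l) y' (y' + m)).
Proof.
  intros Hl Hm Hc HK.
  rewrite (rect_int_split_x P Q x (x + l)) in HK by (auto; lra).
  rewrite (rect_int_split_y P Q x (x + l) y (y + m)) in HK; try lra.
  2:{ intros u v [Hu Hv]. apply Hc. split; lra. }
  rewrite (rect_int_split_y P Q (x + l) (x + 2 * l) y (y + m)) in HK; try lra.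
  2:{ intros u v [Hu Hv]. apply Hc. split; lra. }
  replace (x + 2 * l) with (x + l + l) in HK by ring.
  replace (y + 2 * m) with (y + m + m) in HK by ring.
  destruct (Rle_dec K (Rabs (rect_int P Q x (x + l) y (y + m)))) as [A|A];
    [exists x, y; auto|].
  destruct (Rle_dec K (Rabs (rect_int P Q x (x + l) (y + m) (y + m + m)))) as [B|B];
    [exists x, (y + m); auto|].
  destruct (Rle_dec K (Rabs (rect_int P Q (x + l) (x + l + l) y (y + m)))) as [C|C];
    [exists (x + l), y; auto|].
  destruct (Rle_dec K (Rabs (rect_int P Q (x + l) (x + l + l) (y + m) (y + m + m))))
    as [D|D]; [exists (x + l), (y + m); auto|].
  exfalso. revert HK A B C D. unfold Rabs.
  repeat destruct Rcase_abs; lra.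
Qed.

Lemma nested_intervals (x l : nat -> R) :
  (forall n, x n <= x (S n)) -> (forall n, x (S n) + l (S n) <= x n + l n) ->
  (forall n, 0 <= l n) -> exists p, forall n, x n <= p <= x n + l n.
Proof.
  intros Hi Hd Hl.
  assert (I : forall n k, x n <= x (n + k)%nat).
  { intros n k. induction k; [rewrite Nat.add_0_r; lra|].
    rewrite Nat.add_succ_r. specialize (Hi (n + k)%nat). lra. }
  assert (D : forall n k, x (n + k)%nat + l (n + k)%nat <= x n + l n).
  { intros n k. induction k; [rewrite Nat.add_0_r; lra|].
    rewrite Nat.add_succ_r. specialize (Hd (n + k)%nat). lra. }
  assert (B : forall k n, x k <= x n + l n).
  { intros k n. destruct (Nat.le_ge_cases k n) as [H|H].
    - assert (E := I k (n - k)%nat). replace (k + (n - k))%nat with n in E by lia.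
      specialize (Hl n). lra.
    - assert (E := D n (k - n)%nat). replace (n + (k - n))%nat with k in E by lia.
      specialize (Hl k). lra. }
  destruct (completeness (fun r => exists n, r = x n)) as [p [U L]].
  - exists (x 0%nat + l 0%nat). intros r [n ->]. apply B.
  - exists (x 0%nat), 0%nat. reflexivity.
  - exists p. intros n. split.
    + apply U. now exists n.
    + apply L. intros r [k ->]. apply B.
Qed.

(* Goursat's bisection; for a real one-form [P du + Q dv] only pointwise
   differentiability and the pointwise equality [P_v = Q_u] are needed. *)
Lemma rect_int_closed (P Q : R -> R -> R) (x1 x2 y1 y2 : R) :
  x1 <= x2 -> y1 <= y2 ->
  (forall u v, rect x1 x2 y1 y2 u v -> closed_at P Q u v) ->
  rect_int P Q x1 x2 y1 y2 = 0.
Proof.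
  intros Hx Hy Hc.
  assert (Hc' : forall u v, rect x1 x2 y1 y2 u v -> cont_at P Q u v)
    by (intros u v H; apply closed_at_cont; auto).
  set (K := Rabs (rect_int P Q x1 x2 y1 y2)).
  destruct (Req_dec K 0) as [HK|HK].
  { destruct (Req_dec (rect_int P Q x1 x2 y1 y2) 0) as [|N]; auto.
    now apply Rabs_no_R0 in N. }
  exfalso. assert (PK : 0 < K) by (assert (0 <= K) by apply Rabs_pos; lra).
  set (l := x2 - x1). set (m := y2 - y1).
  assert (Hl : 0 <= l) by (unfold l; lra). assert (Hm : 0 <= m) by (unfold m; lra).
  set (e := fun n : nat => (/ 2) ^ n).
  assert (He : forall n, 0 < e n) by (intros n; apply pow_lt; lra).
  assert (HeS : forall n, e n = 2 * e (S n)) by (intros n; unfold e; simpl; lra).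
  (* A lower left corner is bad at stage n if the n times halved rectangle at it lies in the
     original one and still carries at least a 4^-n share of [K]. *)
  set (bad := fun n (p : R * R) =>
    x1 <= fst p /\ fst p + e n * l <= x2 /\ y1 <= snd p /\ snd p + e n * m <= y2 /\
    e n ^ 2 * K <= Rabs (rect_int P Q (fst p) (fst p + e n * l) (snd p) (snd p + e n * m))).
  (* The recursion runs over corners bundled with their badness, since a next corner is available
     only for a bad one; [step] also records the nesting. *)
  assert (step : forall n (s : {p | bad n p}), {p | bad (S n) p /\
     fst (proj1_sig s) <= fst p /\ fst p + e (S n) * l <= fst (proj1_sig s) + e n * l /\
     snd (proj1_sig s) <= snd p /\ snd p + e (S n) * m <= snd (proj1_sig s) + e n * m}).
  { intros n [[x y] (A & B & C & D & E)]. apply constructive_indefinite_description.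
    cbn [fst snd proj1_sig] in *. rewrite (HeS n) in B, D, E |- *.
    assert (0 <= e (S n) * l) by (apply Rmult_le_pos; auto; apply Rlt_le, He).
    assert (0 <= e (S n) * m) by (apply Rmult_le_pos; auto; apply Rlt_le, He).
    rewrite (Rmult_assoc 2 _ l), (Rmult_assoc 2 _ m) in *.
    destruct (rect_int_quarter P Q x y (e (S n) * l) (e (S n) * m) (e (S n) ^ 2 * K))
      as (x' & y' & Hx' & Hy' & HR); auto.
    - intros u v [Hu Hv]. apply Hc'. split; lra.
    - eapply Rle_trans; [|exact E]. apply Req_le. ring.
    - exists (x', y'). unfold bad; simpl.
      destruct Hx', Hy'; subst; repeat split; auto; lra. }
  assert (bad0 : bad 0%nat (x1, y1)).
  { unfold bad, e; simpl. rewrite !Rmult_1_l.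
    replace (x1 + l) with x2 by (unfold l; ring).
    replace (y1 + m) with y2 by (unfold m; ring).
    repeat split; try lra. fold K; lra. }
  set (st := fix st n : {p | bad n p} := match n with
    | O => exist _ _ bad0
    | S n => exist _ (proj1_sig (step n (st n))) (proj1 (proj2_sig (step n (st n)))) end).
  set (X := fun n => fst (proj1_sig (st n))). set (Y := fun n => snd (proj1_sig (st n))).
  assert (Hn : forall n, X n <= X (S n) /\ X (S n) + e (S n) * l <= X n + e n * l /\
     Y n <= Y (S n) /\ Y (S n) + e (S n) * m <= Y n + e n * m).
  { intros n. unfold X, Y. exact (proj2 (proj2_sig (step n (st n)))). }
  destruct (nested_intervals X (fun n => e n * l)) as [u Hu].
  1,2: intros n; apply Hn.
  1: intros n; apply Rmult_le_pos; auto; apply Rlt_le, He.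
  destruct (nested_intervals Y (fun n => e n * m)) as [v Hv].
  1,2: intros n; apply Hn.
  1: intros n; apply Rmult_le_pos; auto; apply Rlt_le, He.
  assert (Huv : rect x1 x2 y1 y2 u v).
  { destruct (proj2_sig (st 0%nat)) as (A & B & C & D & _). fold (X 0%nat) (Y 0%nat) in *.
    specialize (Hu 0%nat). specialize (Hv 0%nat). split; lra. }
  (* Small enough that eps (l + m)^2 < K; the added 1 keeps the denominator positive when l + m =
     0. *)
  set (eps := K / (2 * ((l + m) ^ 2 + 1))).
  assert (Hq : 0 <= (l + m) ^ 2) by apply pow2_ge_0.
  assert (Heps : 0 < eps) by (apply Rdiv_lt_0_compat; lra).
  destruct (rect_int_closed_small P Q u v eps (Hc u v Huv) Heps) as (d & Hd & Hsmall).
  assert (Hlim : exists n, e n * (l + m + 1) < d).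
  { destruct (pow_lt_1_zero (/ 2) ltac:(rewrite Rabs_right; lra) (d / (l + m + 1)))
      as [n Hn']. apply Rdiv_lt_0_compat; lra.
    exists n. specialize (Hn' n (le_n n)). fold (e n) in Hn'.
    rewrite Rabs_right in Hn' by (apply Rle_ge, Rlt_le, He).
    apply Rlt_div_r in Hn'; lra. }
  destruct Hlim as [n Hlim].
  destruct (proj2_sig (st n)) as (A & B & C & D & E). fold (X n) (Y n) in *.
  assert (Hen := He n).
  assert (0 <= e n * l) by (apply Rmult_le_pos; lra).
  assert (0 <= e n * m) by (apply Rmult_le_pos; lra).
  assert (F := Hsmall (X n) (X n + e n * l) (Y n) (Y n + e n * m)).
  assert (G : Rabs (rect_int P Q (X n) (X n + e n * l) (Y n) (Y n + e n * m)) <=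
     eps * ((X n + e n * l - X n) + (Y n + e n * m - Y n)) ^ 2).
  { apply F.
    - intros u' v' [Hu' Hv']. apply Hc'. split; lra.
    - split; auto.
    - rewrite !Rmult_plus_distr_l in Hlim. lra.
    - rewrite !Rmult_plus_distr_l in Hlim. lra. }
  (* Both bounds carry the factor [e n ^ 2], so the stage cancels and K <= eps (l + m)^2 remains. *)
  replace (eps * ((X n + e n * l - X n) + (Y n + e n * m - Y n)) ^ 2)
    with (e n ^ 2 * (eps * (l + m) ^ 2)) in G by ring.
  assert (W : K <= eps * (l + m) ^ 2).
  { apply Rmult_le_reg_l with (e n ^ 2). apply pow_lt; auto. lra. }
  assert (Z : eps * (2 * ((l + m) ^ 2 + 1)) = K) by (unfold eps; field; lra).
  nra.
Qed.

Lemma rect_int_degenerate_x (P Q : R -> R -> R) (x y1 y2 : R) : rect_int P Q x x y1 y2 = 0.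
Proof.
  unfold rect_int. rewrite RInt_point.
  rewrite (RInt_ext _ (fun _ => 0)) by (intros t _; apply Rminus_diag).
  rewrite RInt_const. unfold scal, zero; simpl; unfold mult; simpl. ring.
Qed.

Lemma rect_int_degenerate_y (P Q : R -> R -> R) (x1 x2 y : R) : rect_int P Q x1 x2 y y = 0.
Proof.
  unfold rect_int. rewrite RInt_point.
  rewrite (RInt_ext _ (fun _ => 0)) by (intros t _; apply Rminus_diag).
  rewrite RInt_const. unfold scal, zero; simpl; unfold mult; simpl. ring.
Qed.

(* One exceptional point of mere continuity is harmless: cut out a small square around it. *)
Lemma rect_int_closed_except (P Q : R -> R -> R) (a b x1 x2 y1 y2 : R) :
  x1 <= x2 -> y1 <= y2 ->
  (forall u v, rect x1 x2 y1 y2 u v -> cont_at P Q u v) ->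
  (forall u v, rect x1 x2 y1 y2 u v -> (u, v) <> (a, b) -> closed_at P Q u v) ->
  rect_int P Q x1 x2 y1 y2 = 0.
Proof.
  intros Hx Hy Hc Hd.
  destruct (excluded_middle_informative (rect x1 x2 y1 y2 a b)) as [Hab|Hab].
  2:{ apply rect_int_closed; auto. intros u v H. apply Hd; auto.
      intros E. inversion E; subst. contradiction. }
  destruct (Hc a b Hab) as [CP CQ].
  destruct (CP (mkposreal 1 Rlt_0_1)) as [d1 H1]. destruct (CQ (mkposreal 1 Rlt_0_1)) as [d2 H2].
  simpl in H1, H2. assert (P1 := cond_pos d1). assert (P2 := cond_pos d2).
  assert (M1 : Rmin d1 d2 <= d1) by apply Rmin_l. assert (M2 : Rmin d1 d2 <= d2) by apply Rmin_r.
  assert (P3 : 0 < Rmin d1 d2) by now apply Rmin_pos.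
  destruct Hab as [Ha Hb].
  (* Inside the cut-out square each of [P] and [Q] is within 1 of its value at (a, b), so the paired
     differences are at most 2, while the half perimeter is at most 4 d. *)
  assert (Small : forall d, 0 < d < Rmin d1 d2 ->
     Rabs (rect_int P Q x1 x2 y1 y2) <= 8 * d).
  { intros d Hd'.
    (* The square is clipped to the rectangle. Either a clipped edge lies on the rectangle's own
       edge, and the strip beyond it is degenerate, or that strip keeps clear of (a, b). *)
    set (u1 := Rmax x1 (a - d)). set (u2 := Rmin x2 (a + d)).
    set (v1 := Rmax y1 (b - d)). set (v2 := Rmin y2 (b + d)).
    assert (U1 : x1 <= u1 <= a /\ a - d <= u1 /\ (u1 = x1 \/ u1 < a))
      by (unfold u1, Rmax; destruct Rle_dec; lra).
    assert (U2 : a <= u2 <= x2 /\ u2 <= a + d /\ (u2 = x2 \/ a < u2))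
      by (unfold u2, Rmin; destruct Rle_dec; lra).
    assert (V1 : y1 <= v1 <= b /\ b - d <= v1 /\ (v1 = y1 \/ v1 < b))
      by (unfold v1, Rmax; destruct Rle_dec; lra).
    assert (V2 : b <= v2 <= y2 /\ v2 <= b + d /\ (v2 = y2 \/ b < v2))
      by (unfold v2, Rmin; destruct Rle_dec; lra).
    assert (Z1 : rect_int P Q x1 u1 y1 y2 = 0).
    { destruct U1 as (? & ? & [-> | L]); [apply rect_int_degenerate_x|].
      apply rect_int_closed; try lra. intros u v [Hu Hv]. apply Hd. split; lra.
      intros E; inversion E; lra. }
    assert (Z2 : rect_int P Q u2 x2 y1 y2 = 0).
    { destruct U2 as (? & ? & [-> | L]); [apply rect_int_degenerate_x|].
      apply rect_int_closed; try lra. intros u v [Hu Hv]. apply Hd. split; lra.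
      intros E; inversion E; lra. }
    assert (Z3 : rect_int P Q u1 u2 y1 v1 = 0).
    { destruct V1 as (? & ? & [-> | L]); [apply rect_int_degenerate_y|].
      apply rect_int_closed; try lra. intros u v [Hu Hv]. apply Hd. split; lra.
      intros E; inversion E; lra. }
    assert (Z4 : rect_int P Q u1 u2 v2 y2 = 0).
    { destruct V2 as (? & ? & [-> | L]); [apply rect_int_degenerate_y|].
      apply rect_int_closed; try lra. intros u v [Hu Hv]. apply Hd. split; lra.
      intros E; inversion E; lra. }
    rewrite (rect_int_split_x P Q x1 u1 x2), Z1 by (auto; lra).
    rewrite (rect_int_split_x P Q u1 u2 x2), Z2;
      [|intros u v [? ?]; apply Hc; split; lra|lra|lra].
    rewrite (rect_int_split_y P Q u1 u2 y1 v1 y2), Z3;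
      [|intros u v [? ?]; apply Hc; split; lra|lra|lra].
    rewrite (rect_int_split_y P Q u1 u2 v1 v2 y2), Z4;
      [|intros u v [? ?]; apply Hc; split; lra|lra|lra].
    rewrite Rplus_0_l, Rplus_0_r, Rplus_0_l, Rplus_0_r.
    assert (T : Rabs (rect_int P Q u1 u2 v1 v2) <= (u2 - u1 + (v2 - v1)) * 2).
    { assert (N : forall s t, u1 <= s <= u2 -> v1 <= t <= v2 ->
         Rabs (s - a) < Rmin d1 d2 /\ Rabs (t - b) < Rmin d1 d2).
      { intros s t Hs Ht. split; apply Rabs_def1; lra. }
      apply (rect_int_near P Q u1 u2 v1 v2 0 0); try lra.
      - intros u v [? ?]; apply Hc; split; lra.
      - intros s Hs.
        destruct (N s v1 Hs ltac:(lra)) as [N1 N2]. destruct (N s v2 Hs ltac:(lra)) as [N3 N4].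
        assert (W1 := H1 s v1 ltac:(lra) ltac:(lra)).
        assert (W2 := H1 s v2 ltac:(lra) ltac:(lra)).
        apply Rabs_def2 in W1. apply Rabs_def2 in W2. apply Rabs_le; lra.
      - intros t Ht.
        destruct (N u1 t ltac:(lra) Ht) as [N1 N2]. destruct (N u2 t ltac:(lra) Ht) as [N3 N4].
        assert (W1 := H2 u1 t ltac:(lra) ltac:(lra)).
        assert (W2 := H2 u2 t ltac:(lra) ltac:(lra)).
        apply Rabs_def2 in W1. apply Rabs_def2 in W2. apply Rabs_le; lra. }
    lra. }
  destruct (Req_dec (rect_int P Q x1 x2 y1 y2) 0) as [E|E]; auto. exfalso.
  apply Rabs_pos_lt in E. set (K := Rabs _) in *.
  assert (F := Small (Rmin (Rmin d1 d2 / 2) (K / 16))).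
  assert (Rmin (Rmin d1 d2 / 2) (K / 16) <= Rmin d1 d2 / 2) by apply Rmin_l.
  assert (Rmin (Rmin d1 d2 / 2) (K / 16) <= K / 16) by apply Rmin_r.
  assert (0 < Rmin (Rmin d1 d2 / 2) (K / 16)) by (apply Rmin_pos; lra).
  lra.
Qed.

(** * Potentials on boxes *)


Definition box (a b r u v : R) : Prop := Rabs (u - a) < r /\ Rabs (v - b) < r.

Lemma box_locally (a b r u v : R) : box a b r u v ->
  exists d : posreal, forall u' v', Rabs (u' - u) < d -> Rabs (v' - v) < d -> box a b r u' v'.
Proof.
  intros [Hu Hv].
  assert (H : 0 < Rmin (r - Rabs (u - a)) (r - Rabs (v - b))) by (apply Rmin_pos; lra).
  exists (mkposreal _ H). simpl. intros u' v' Hu' Hv'.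
  assert (M1 := Rmin_l (r - Rabs (u - a)) (r - Rabs (v - b))).
  assert (M2 := Rmin_r (r - Rabs (u - a)) (r - Rabs (v - b))).
  split.
  - replace (u' - a) with ((u' - u) + (u - a)) by ring.
    eapply Rle_lt_trans; [apply Rabs_triang|]. lra.
  - replace (v' - b) with ((v' - v) + (v - b)) by ring.
    eapply Rle_lt_trans; [apply Rabs_triang|]. lra.
Qed.

Lemma Rabs_between_convex (x1 x2 x a r : R) :
  Rabs (x1 - a) < r -> Rabs (x2 - a) < r -> Rmin x1 x2 <= x <= Rmax x1 x2 ->
  Rabs (x - a) < r.
Proof.
  intros H1 H2. apply Rabs_def2 in H1. apply Rabs_def2 in H2.
  unfold Rmin, Rmax. destruct (Rle_dec x1 x2); intros H; apply Rabs_def1; lra.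
Qed.

Lemma differentiable_pt_lim_partials (f df : R -> R -> R) (x y dy : R) :
  locally_2d (fun u v => is_derive (fun z => f z v) u (df u v)) x y ->
  is_derive (fun z => f x z) y dy -> continuity_2d_pt df x y ->
  differentiable_pt_lim f x y (df x y) dy.
Proof.
  intros [d Hd] Hy Hc. apply filterdiff_differentiable_pt_lim.
  apply (is_derive_filterdiff f x y df dy).
  - exists d. intros [u v] [Hu Hv]. simpl in *. apply Hd; assumption.
  - exact Hy.
  - now apply continuity_2d_pt_filterlim in Hc.
Qed.

(** [RInt] is oriented, so exchanging two opposite sides changes the sign of [rect_int] and the
    corners may be assumed ordered. A potential based at the centre of a box meets all four
    orders. *)
Lemma rect_int_box (P Q : R -> R -> R) (a b r c d x1 x2 y1 y2 : R) :
  (forall u v, box a b r u v -> cont_at P Q u v) ->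
  (forall u v, box a b r u v -> (u, v) <> (c, d) -> closed_at P Q u v) ->
  box a b r x1 y1 -> box a b r x2 y2 -> rect_int P Q x1 x2 y1 y2 = 0.
Proof.
  intros Hc Hd.
  assert (EH : forall x1 x2 y, box a b r x1 y -> box a b r x2 y ->
             ex_RInt (fun s => P s y) x1 x2).
  { intros s1 s2 y [H1 Hy] [H2 _]. apply (ex_RInt_continuous (V := R_CompleteNormedModule)).
    intros s Hs. apply continuity_2d_pt_fst. apply Hc. split; auto.
    now apply (Rabs_between_convex s1 s2). }
  assert (EV : forall y1 y2 x, box a b r x y1 -> box a b r x y2 ->
             ex_RInt (fun t => Q x t) y1 y2).
  { intros s1 s2 y [Hy H1] [_ H2]. apply (ex_RInt_continuous (V := R_CompleteNormedModule)).
    intros s Hs. apply continuity_2d_pt_snd. apply Hc. split; auto.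
    now apply (Rabs_between_convex s1 s2). }
  assert (Main : forall x1 x2 y1 y2, x1 <= x2 -> y1 <= y2 ->
     box a b r x1 y1 -> box a b r x2 y2 -> rect_int P Q x1 x2 y1 y2 = 0).
  { intros s1 s2 t1 t2 Hs Ht [A1 B1] [A2 B2].
    assert (I : forall u v, rect s1 s2 t1 t2 u v -> box a b r u v).
    { intros u v [Hu Hv]. split.
      - apply (Rabs_between_convex s1 s2); auto. now rewrite Rmin_left, Rmax_right.
      - apply (Rabs_between_convex t1 t2); auto. now rewrite Rmin_left, Rmax_right. }
    apply (rect_int_closed_except P Q c d); auto. }
  assert (SX : forall x1 x2 y1 y2, box a b r x1 y1 -> box a b r x2 y2 ->
     rect_int P Q x2 x1 y1 y2 = - rect_int P Q x1 x2 y1 y2).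
  { intros s1 s2 t1 t2 [A1 B1] [A2 B2]. unfold rect_int.
    rewrite <- (opp_RInt_swap (V := R_CompleteNormedModule) _ s1 s2)
      by (apply ex_RInt_Rminus; apply EH; split; auto).
    rewrite (RInt_Rminus (fun t => Q s1 t) (fun t => Q s2 t)),
      (RInt_Rminus (fun t => Q s2 t) (fun t => Q s1 t)) by (apply EV; split; auto).
    unfold opp; simpl. ring. }
  assert (SY : forall x1 x2 y1 y2, box a b r x1 y1 -> box a b r x2 y2 ->
     rect_int P Q x1 x2 y2 y1 = - rect_int P Q x1 x2 y1 y2).
  { intros s1 s2 t1 t2 [A1 B1] [A2 B2]. unfold rect_int.
    rewrite <- (opp_RInt_swap (V := R_CompleteNormedModule) _ t1 t2)
      by (apply ex_RInt_Rminus; apply EV; split; auto).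
    rewrite (RInt_Rminus (fun t => P t t2) (fun t => P t t1)),
      (RInt_Rminus (fun t => P t t1) (fun t => P t t2)) by (apply EH; split; auto).
    unfold opp; simpl. ring. }
  intros H1 H2. assert (H1' := H1). assert (H2' := H2).
  destruct H1' as [A1 B1], H2' as [A2 B2].
  destruct (Rle_dec x1 x2) as [X|X], (Rle_dec y1 y2) as [Y|Y].
  - apply Main; auto.
  - rewrite SY by (split; auto). rewrite Main; try lra; split; auto.
  - rewrite SX by (split; auto). rewrite Main; try lra; split; auto.
  - rewrite SY, SX by (split; auto). rewrite Main; try lra; split; auto.
Qed.

(** The potential is the integral along either two-sided path from the centre. The path ending on a
    vertical side exhibits the v-derivative, the one ending on a horizontal side the u-derivative,
    and continuity of [P] turns the two partials into a differential. *)
Lemma local_potential_except (P Q : R -> R -> R) (a b r c d : R) :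
  (forall u v, box a b r u v -> cont_at P Q u v) ->
  (forall u v, box a b r u v -> (u, v) <> (c, d) -> closed_at P Q u v) ->
  exists L : R -> R -> R, forall u v, box a b r u v ->
    differentiable_pt_lim L u v (P u v) (Q u v).
Proof.
  intros Hc Hd.
  set (L := fun x y => RInt (fun s => P s b) a x + RInt (fun t => Q x t) b y).
  assert (EH : forall x1 x2 y, box a b r x1 y -> box a b r x2 y ->
             ex_RInt (fun s => P s y) x1 x2).
  { intros s1 s2 y [H1 Hy] [H2 _]. apply (ex_RInt_continuous (V := R_CompleteNormedModule)).
    intros s Hs. apply continuity_2d_pt_fst. apply Hc. split; auto.
    now apply (Rabs_between_convex s1 s2). }
  assert (EV : forall y1 y2 x, box a b r x y1 -> box a b r x y2 ->
             ex_RInt (fun t => Q x t) y1 y2).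
  { intros s1 s2 y [Hy H1] [_ H2]. apply (ex_RInt_continuous (V := R_CompleteNormedModule)).
    intros s Hs. apply continuity_2d_pt_snd. apply Hc. split; auto.
    now apply (Rabs_between_convex s1 s2). }
  assert (C0 : forall u v, box a b r u v -> Rabs (a - a) < r /\ Rabs (b - b) < r).
  { intros u v [Hu Hv]. rewrite !Rminus_diag, Rabs_R0.
    assert (0 <= Rabs (u - a)) by apply Rabs_pos. lra. }
  assert (L2 : forall x y, box a b r x y ->
     L x y = RInt (fun t => Q a t) b y + RInt (fun s => P s y) a x).
  { intros x y Hxy. destruct (C0 x y Hxy) as [Ca Cb]. destruct Hxy as [Hx Hy].
    assert (Z := rect_int_box P Q a b r c d a x b y Hc Hd
                   ltac:(split; auto) ltac:(split; auto)).
    unfold rect_int in Z.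
    rewrite (RInt_Rminus (fun s => P s b) (fun s => P s y)),
      (RInt_Rminus (fun t => Q x t) (fun t => Q a t)) in Z.
    - unfold L. lra.
    - apply EV; split; auto.
    - apply EV; split; auto.
    - apply EH; split; auto.
    - apply EH; split; auto. }
  assert (DX : forall x y, box a b r x y -> is_derive (fun s => L s y) x (P x y)).
  { intros x y Hxy. destruct (C0 x y Hxy) as [Ca Cb].
    destruct (box_locally a b r x y Hxy) as [e He].
    apply (is_derive_ext_loc (fun s => RInt (fun t => Q a t) b y + RInt (fun s => P s y) a s)).
    - exists e. intros s Hs. symmetry. apply L2. apply He; auto.
      rewrite Rminus_diag, Rabs_R0. apply cond_pos.
    - replace (P x y) with (0 + P x y) by ring.
      apply (is_derive_plus (K := R_AbsRing) (V := R_NormedModule)).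
      + apply (is_derive_const (K := R_AbsRing) (V := R_NormedModule)).
      + apply (is_derive_RInt (V := R_NormedModule) (fun s => P s y) _ a x).
        * exists e. intros s Hs. apply (RInt_correct (V := R_CompleteNormedModule)).
          destruct Hxy. apply EH.
          -- split; auto.
          -- apply He; auto. rewrite Rminus_diag, Rabs_R0. apply cond_pos.
        * apply (continuity_2d_pt_fst P). now apply Hc. }
  assert (DY : forall x y, box a b r x y -> is_derive (fun t => L x t) y (Q x y)).
  { intros x y Hxy. destruct (C0 x y Hxy) as [Ca Cb].
    destruct (box_locally a b r x y Hxy) as [e He].
    unfold L. replace (Q x y) with (0 + Q x y) by ring.
    apply (is_derive_plus (K := R_AbsRing) (V := R_NormedModule)).
    + apply (is_derive_const (K := R_AbsRing) (V := R_NormedModule)).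
    + apply (is_derive_RInt (V := R_NormedModule) (fun s => Q x s) _ b y).
      * exists e. intros s Hs. apply (RInt_correct (V := R_CompleteNormedModule)).
        destruct Hxy. apply EV.
        -- split; auto.
        -- apply He; auto. rewrite Rminus_diag, Rabs_R0. apply cond_pos.
      * apply (continuity_2d_pt_snd Q). now apply Hc. }
  exists L. intros u v Huv. apply differentiable_pt_lim_partials.
  - destruct (box_locally a b r u v Huv) as [e He]. exists e. intros u' v' Hu' Hv'.
    apply DX. auto.
  - now apply DY.
  - now apply Hc.
Qed.

Lemma local_potential (P Q : R -> R -> R) (a b r : R) :
  (forall u v, box a b r u v -> closed_at P Q u v) ->
  exists L : R -> R -> R, forall u v, box a b r u v ->
    differentiable_pt_lim L u v (P u v) (Q u v).
Proof.
  intros H. apply (local_potential_except P Q a b r 0 0); auto.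
  intros u v Huv. apply closed_at_cont. auto.
Qed.

Lemma continuous_comp_2d (F : R -> R -> R) (g1 g2 : R -> R) (t : R) :
  continuity_2d_pt F (g1 t) (g2 t) -> continuous g1 t -> continuous g2 t ->
  continuous (fun s => F (g1 s) (g2 s)) t.
Proof.
  intros HF H1 H2. apply (continuous_comp_2 g1 g2 F); auto.
  now apply continuity_2d_pt_filterlim in HF.
Qed.

Lemma derivable_pt_lim_continuous (g : R -> R) (t l : R) :
  derivable_pt_lim g t l -> continuous g t.
Proof.
  intros H. apply (ex_derive_continuous (K := R_AbsRing) (V := R_NormedModule)).
  exists l. now apply is_derive_Reals.
Qed.

Lemma path_integral_potential (L P Q : R -> R -> R) (g1 g2 g1' g2' : R -> R) (a b : R) :
  a <= b ->
  (forall t, a <= t <= b ->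
     differentiable_pt_lim L (g1 t) (g2 t) (P (g1 t) (g2 t)) (Q (g1 t) (g2 t)) /\
     cont_at P Q (g1 t) (g2 t) /\
     derivable_pt_lim g1 t (g1' t) /\ derivable_pt_lim g2 t (g2' t) /\
     continuous g1' t /\ continuous g2' t) ->
  RInt.is_RInt (fun t => P (g1 t) (g2 t) * g1' t + Q (g1 t) (g2 t) * g2' t) a b
    (L (g1 b) (g2 b) - L (g1 a) (g2 a)).
Proof.
  intros Hab H.
  apply (is_RInt_derive (V := R_CompleteNormedModule) (fun t => L (g1 t) (g2 t))).
  - intros t Ht. rewrite Rmin_left, Rmax_right in Ht by lra.
    destruct (H t Ht) as (HL & _ & D1 & D2 & _). apply is_derive_Reals.
    now apply derivable_pt_lim_comp_2d.
  - intros t Ht. rewrite Rmin_left, Rmax_right in Ht by lra.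
    destruct (H t Ht) as (HL & [CP CQ] & D1 & D2 & C1 & C2).
    apply (continuous_plus (V := R_NormedModule));
      apply (continuous_mult (K := R_AbsRing)); auto;
      apply continuous_comp_2d; eauto using derivable_pt_lim_continuous.
Qed.

(** * Complex derivatives *)


Definition cderiv (f : C -> C) (z c : C) : Prop :=
  forall eps, 0 < eps -> exists d, 0 < d /\ forall k : C, Cmod k < d ->
    Cmod (f (z + k) - f z - c * k)%C <= eps * Cmod k.

Definition uncurryC (phi : R -> R -> Cx) (z : C) : C := phi (fst z) (snd z).

Lemma Cmod_sqr (z : C) : Cmod z ^ 2 = fst z ^ 2 + snd z ^ 2.
Proof. exact (Cmod2_alt z). Qed.

Lemma Rle_of_sqr (a b : R) : 0 <= b -> a ^ 2 <= b ^ 2 -> a <= b.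
Proof. intros Hb H. nra. Qed.

Lemma Rlt_of_sqr (a b : R) : 0 <= b -> a ^ 2 < b ^ 2 -> a < b.
Proof. intros Hb H. nra. Qed.

Lemma Rabs_fst_le_Cmod (z : C) : Rabs (fst z) <= Cmod z.
Proof. eapply Rle_trans; [apply Rmax_l | apply Rmax_Cmod]. Qed.

Lemma Rabs_snd_le_Cmod (z : C) : Rabs (snd z) <= Cmod z.
Proof. eapply Rle_trans; [apply Rmax_r | apply Rmax_Cmod]. Qed.

Lemma Cmod_le_sum (z : C) : Cmod z <= Rabs (fst z) + Rabs (snd z).
Proof.
  assert (A := Rabs_pos (fst z)). assert (B := Rabs_pos (snd z)).
  apply Rle_of_sqr; [lra|].
  rewrite Cmod_sqr, <- (pow2_abs (fst z)), <- (pow2_abs (snd z)). nra.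
Qed.

(** Squared moduli are traded for moduli, and the increment 0, which [holomorphic] excludes,
    satisfies the estimate trivially. *)
Lemma holomorphic_cderiv (U : R -> R -> Prop) (phi : R -> R -> Cx) :
  holomorphic U phi <->
  (forall u v, U u v -> exists c, cderiv (uncurryC phi) (u, v) c).
Proof.
  split; intros H u v Huv; destruct (H u v Huv) as [c Hc]; exists c; intros eps Heps;
    destruct (Hc eps Heps) as (d & Hd & Hk); exists d; split; auto.
  - intros k Hkd.
    destruct (Req_dec (Cmod k) 0) as [E|E].
    + rewrite E. apply Cmod_eq_0 in E. rewrite E.
      replace (_ - _ - _)%C with (RtoC 0).
      * rewrite Cmod_0. lra.
      * replace ((u, v) + 0)%C with (u, v) by (now rewrite Cplus_0_r). ring.
    + assert (P := Cmod_ge_0 k).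
      apply Rle_of_sqr; [apply Rmult_le_pos; lra|].
      rewrite Rpow_mult_distr, (Cmod_sqr k), Cmod_sqr.
      apply (Hk (fst k) (snd k)). rewrite <- Cmod_sqr. nra.
  - intros h k [H0 Hhk].
    assert (M : Cmod (h, k) ^ 2 = h ^ 2 + k ^ 2) by (rewrite Cmod_sqr; reflexivity).
    rewrite <- M in H0, Hhk |- *.
    assert (G := Hk (h, k) (Rlt_of_sqr _ _ (Rlt_le _ _ Hd) Hhk)).
    unfold Cnorm2. rewrite <- Rpow_mult_distr.
    rewrite <- (Cmod_sqr (Csub (Csub (phi (u + h) (v + k)) (phi u v)) (Cmul c (h, k)))).
    apply pow_incr. split; [apply Cmod_ge_0|]. exact G.
Qed.

Lemma cderiv_differentiable (f : C -> C) (u v : R) (c : C) : cderiv f (u, v) c ->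
  differentiable_pt_lim (fun s t => fst (f (s, t))) u v (fst c) (- snd c) /\
  differentiable_pt_lim (fun s t => snd (f (s, t))) u v (snd c) (fst c).
Proof.
  intros H.
  assert (G : forall eps : posreal, exists d : posreal, forall s t,
    Rabs (s - u) < d -> Rabs (t - v) < d ->
    Cmod (f (s, t) - f (u, v) - c * (s - u, t - v)%R)%C
      <= eps * Rmax (Rabs (s - u)) (Rabs (t - v))).
  { intros eps. assert (P := cond_pos eps).
    (* The halves compensate for |k| <= 2 max (|s - u|, |t - v|), the maximum being the norm in
       [differentiable_pt_lim]. *)
    destruct (H (eps / 2) ltac:(lra)) as (d & Hd & Hk).
    exists (mkposreal (d / 2) ltac:(lra)). simpl. intros s t Hs Ht.
    assert (M := Cmod_le_sum (s - u, t - v)). simpl in M.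
    assert (N1 := Rmax_l (Rabs (s - u)) (Rabs (t - v))).
    assert (N2 := Rmax_r (Rabs (s - u)) (Rabs (t - v))).
    assert (K := Hk (s - u, t - v) ltac:(lra)).
    replace ((u, v) + (s - u, t - v)%R)%C with (s, t) in K
      by (unfold Cplus; simpl; f_equal; ring).
    nra. }
  split; intros eps; destruct (G eps) as [d Hd]; exists d; intros s t Hs Ht;
    (eapply Rle_trans; [|apply (Hd s t Hs Ht)]).
  - eapply Rle_trans; [|apply Rabs_fst_le_Cmod].
    apply Req_le. simpl. f_equal. ring.
  - eapply Rle_trans; [|apply Rabs_snd_le_Cmod].
    apply Req_le. simpl. f_equal. ring.
Qed.

Lemma differentiable_cderiv (f : C -> C) (u v a b : R) :
  differentiable_pt_lim (fun s t => fst (f (s, t))) u v a (- b) ->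
  differentiable_pt_lim (fun s t => snd (f (s, t))) u v b a ->
  cderiv f (u, v) (a, b).
Proof.
  intros H1 H2 eps Heps.
  destruct (H1 (mkposreal (eps / 2) ltac:(lra))) as [d1 D1].
  destruct (H2 (mkposreal (eps / 2) ltac:(lra))) as [d2 D2]. simpl in D1, D2.
  exists (Rmin d1 d2). split; [apply Rmin_pos; apply cond_pos|].
  intros [h k] Hk.
  assert (A := Rabs_fst_le_Cmod (h, k)). assert (B := Rabs_snd_le_Cmod (h, k)).
  assert (N := Rmax_Cmod (h, k)). simpl in A, B, N.
  assert (M1 := Rmin_l d1 d2). assert (M2 := Rmin_r d1 d2).
  assert (E1 := D1 (u + h) (v + k)). assert (E2 := D2 (u + h) (v + k)).
  replace (u + h - u) with h in E1, E2 by ring. replace (v + k - v) with k in E1, E2 by ring.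
  specialize (E1 ltac:(lra) ltac:(lra)). specialize (E2 ltac:(lra) ltac:(lra)).
  change ((u, v) + (h, k))%C with (u + h, v + k).
  eapply Rle_trans; [apply Cmod_le_sum|].
  apply Rle_trans with (eps / 2 * Rmax (Rabs h) (Rabs k) + eps / 2 * Rmax (Rabs h) (Rabs k)).
  - apply Rplus_le_compat.
    + eapply Rle_trans; [|exact E1]. apply Req_le; simpl. f_equal. ring.
    + eapply Rle_trans; [|exact E2]. apply Req_le; simpl. f_equal. ring.
  - nra.
Qed.

Lemma cderiv_continuity (f : C -> C) (u v : R) (c : C) : cderiv f (u, v) c ->
  continuity_2d_pt (fun s t => fst (f (s, t))) u v /\
  continuity_2d_pt (fun s t => snd (f (s, t))) u v.
Proof.
  intros H. apply cderiv_differentiable in H. destruct H as [H1 H2].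
  split; apply differentiable_continuity_pt; do 2 eexists; eassumption.
Qed.

(** Re (f dw) = Re f du - Im f dv and Im (f dw) = Im f du + Re f dv; the Cauchy-Riemann equations
    are the closedness of these two forms. *)
Lemma cderiv_closed (f : C -> C) (u v : R) (c : C) : cderiv f (u, v) c ->
  closed_at (fun s t => fst (f (s, t))) (fun s t => - snd (f (s, t))) u v /\
  closed_at (fun s t => snd (f (s, t))) (fun s t => fst (f (s, t))) u v.
Proof.
  intros H. apply cderiv_differentiable in H. destruct H as [H1 H2]. split.
  - exists (fst c), (- snd c), (- fst c). split; auto.
    intros eps. destruct (H2 eps) as [d Hd]. exists d. intros s t Hs Ht.
    eapply Rle_trans; [|apply (Hd s t Hs Ht)]. apply Req_le.
    rewrite <- Rabs_Ropp. f_equal. ring.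
  - exists (snd c), (fst c), (- snd c). auto.
Qed.

Lemma cderiv_ext_loc (f g : C -> C) (z c : C) (r : R) : 0 < r ->
  (forall k, Cmod k < r -> f (z + k)%C = g (z + k)%C) -> cderiv f z c -> cderiv g z c.
Proof.
  intros Hr E H eps Heps. destruct (H eps Heps) as (d & Hd & Hk).
  exists (Rmin d r). split; [now apply Rmin_pos|]. intros k Hkd.
  assert (M1 := Rmin_l d r). assert (M2 := Rmin_r d r).
  rewrite <- (E k) by lra.
  assert (E0 := E (RtoC 0)). rewrite Cmod_0, Cplus_0_r in E0. rewrite <- E0 by lra.
  apply Hk. lra.
Qed.

(** An explicit second-order remainder is what the Cauchy kernels deliver, and it survives
    integration over a parameter. *)
Lemma cderiv_quadratic (f : C -> C) (z c : C) (r K : R) : 0 < r ->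
  (forall k, Cmod k < r -> Cmod (f (z + k) - f z - c * k)%C <= K * Cmod k ^ 2) ->
  cderiv f z c.
Proof.
  intros Hr H eps Heps.
  assert (PK : 0 < Rabs K + 1) by (assert (A := Rabs_pos K); lra).
  assert (PE : 0 < eps / (Rabs K + 1)) by now apply Rdiv_lt_0_compat.
  exists (Rmin r (eps / (Rabs K + 1))). split; [now apply Rmin_pos|].
  intros k Hk. assert (M1 := Rmin_l r (eps / (Rabs K + 1))).
  assert (M2 := Rmin_r r (eps / (Rabs K + 1))).
  eapply Rle_trans; [apply H; lra|].
  assert (G := Cmod_ge_0 k). assert (A := Rle_abs K).
  assert (B : (Rabs K + 1) * Cmod k <= eps).
  { assert (W : Cmod k < eps / (Rabs K + 1)) by lra.
    apply (Rlt_div_r (Cmod k) eps (Rabs K + 1)) in W; lra. }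
  nra.
Qed.

Lemma Cmod_triangle3 (a b c : C) : Cmod (a + b + c)%C <= Cmod a + Cmod b + Cmod c.
Proof.
  eapply Rle_trans; [apply Cmod_triangle|].
  apply Rplus_le_compat_r. apply Cmod_triangle.
Qed.

Lemma cderiv_lipschitz (f : C -> C) (z c : C) : cderiv f z c ->
  exists d, 0 < d /\ forall k, Cmod k < d -> Cmod (f (z + k) - f z)%C <= (Cmod c + 1) * Cmod k.
Proof.
  intros H. destruct (H 1 Rlt_0_1) as (d & Hd & Hk). exists d. split; auto.
  intros k Hkd. specialize (Hk k Hkd).
  replace (f (z + k) - f z)%C with ((f (z + k) - f z - c * k) + c * k)%C by ring.
  eapply Rle_trans; [apply Cmod_triangle|]. rewrite Cmod_mult. lra.
Qed.

Lemma cderiv_mult (f g : C -> C) (z a b : C) : cderiv f z a -> cderiv g z b ->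
  cderiv (fun w => f w * g w)%C z (a * g z + f z * b)%C.
Proof.
  intros Hf Hg eps Heps.
  destruct (cderiv_lipschitz f z a Hf) as (d0 & Hd0 & L0).
  set (A := Cmod a + 1). set (B := Cmod b + 1).
  set (F := Cmod (f z) + 1). set (G := Cmod (g z) + 1).
  assert (PA : 1 <= A) by (unfold A; assert (X := Cmod_ge_0 a); lra).
  assert (PB : 1 <= B) by (unfold B; assert (X := Cmod_ge_0 b); lra).
  assert (PF : 1 <= F) by (unfold F; assert (X := Cmod_ge_0 (f z)); lra).
  assert (PG : 1 <= G) by (unfold G; assert (X := Cmod_ge_0 (g z)); lra).
  destruct (Hf (eps / (3 * G)) ltac:(apply Rdiv_lt_0_compat; lra)) as (d1 & Hd1 & L1).
  destruct (Hg (eps / (3 * F)) ltac:(apply Rdiv_lt_0_compat; lra)) as (d2 & Hd2 & L2).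
  (* The first bound keeps |f (z + k)| at most [F]; the second controls the increment of [f] times b
     k. *)
  set (d3 := Rmin (/ A) (eps / (3 * (A * B)))).
  assert (PAB : 1 <= A * B) by nra.
  assert (P3 : 0 < d3).
  { apply Rmin_pos; [apply Rinv_0_lt_compat; lra | apply Rdiv_lt_0_compat; lra]. }
  exists (Rmin (Rmin d0 d1) (Rmin d2 d3)).
  split; [apply Rmin_pos; apply Rmin_pos; assumption|]. intros k Hk.
  assert (K0 : Cmod k < d0 /\ Cmod k < d1 /\ Cmod k < d2 /\ Cmod k < d3).
  { repeat split; (eapply Rlt_le_trans; [exact Hk|]).
    - eapply Rle_trans; [apply Rmin_l|apply Rmin_l].
    - eapply Rle_trans; [apply Rmin_l|apply Rmin_r].
    - eapply Rle_trans; [apply Rmin_r|apply Rmin_l].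
    - eapply Rle_trans; [apply Rmin_r|apply Rmin_r]. }
  destruct K0 as (K0 & K1 & K2 & K3).
  specialize (L0 k K0). specialize (L1 k K1). specialize (L2 k K2). fold A in L0.
  assert (PK := Cmod_ge_0 k).
  assert (K4 : A * Cmod k <= 1).
  { assert (W : Cmod k <= / A)
      by (assert (X := Rmin_l (/ A) (eps / (3 * (A * B)))); unfold d3 in K3; lra).
    apply Rmult_le_compat_l with (r := A) in W; [|lra]. rewrite Rinv_r in W; lra. }
  assert (K5 : A * B * Cmod k <= eps / 3).
  { assert (W : Cmod k <= eps / (3 * (A * B)))
      by (assert (X := Rmin_r (/ A) (eps / (3 * (A * B)))); unfold d3 in K3; lra).
    apply Rmult_le_compat_l with (r := A * B) in W; [|lra].
    replace (A * B * (eps / (3 * (A * B)))) with (eps / 3) in W by (field; lra). lra. }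
  assert (Fk : Cmod (f (z + k)%C) <= F).
  { replace (f (z + k)%C) with ((f (z + k) - f z) + f z)%C by ring.
    eapply Rle_trans; [apply Cmod_triangle|]. unfold F. lra. }
  replace (f (z + k) * g (z + k) - f z * g z - (a * g z + f z * b) * k)%C with
    (f (z + k) * (g (z + k) - g z - b * k) + (f (z + k) - f z - a * k) * g z
      + (f (z + k) - f z) * (b * k))%C by ring.
  eapply Rle_trans; [apply Cmod_triangle3|]. rewrite !Cmod_mult.
  set (p := Cmod (f (z + k)%C)) in *. set (x1 := Cmod (f (z + k) - f z - a * k)%C) in *.
  set (x2 := Cmod (g (z + k) - g z - b * k)%C) in *. set (x0 := Cmod (f (z + k) - f z)%C) in *.
  assert (T1 : p * x2 <= eps / 3 * Cmod k).
  { apply Rle_trans with (F * (eps / (3 * F) * Cmod k)).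
    - apply Rmult_le_compat; auto; apply Cmod_ge_0.
    - apply Req_le. field. lra. }
  assert (T2 : x1 * Cmod (g z) <= eps / 3 * Cmod k).
  { apply Rle_trans with ((eps / (3 * G) * Cmod k) * G).
    - apply Rmult_le_compat; auto; try apply Cmod_ge_0. unfold G; lra.
    - apply Req_le. field. lra. }
  assert (T3 : x0 * (Cmod b * Cmod k) <= eps / 3 * Cmod k).
  { apply Rle_trans with ((A * Cmod k) * (B * Cmod k)).
    - apply Rmult_le_compat; auto; try apply Cmod_ge_0.
      + apply Rmult_le_pos; apply Cmod_ge_0.
      + apply Rmult_le_compat_r; auto. unfold B; lra.
    - replace ((A * Cmod k) * (B * Cmod k)) with ((A * B * Cmod k) * Cmod k) by ring.
      apply Rmult_le_compat_r; auto. }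
  lra.
Qed.

Lemma cderiv_const (c z : C) : cderiv (fun _ => c) z 0.
Proof.
  apply (cderiv_quadratic _ _ _ 1 0 Rlt_0_1). intros k _.
  replace (c - c - 0 * k)%C with (RtoC 0) by ring. rewrite Cmod_0. lra.
Qed.

Lemma cderiv_scal (f : C -> C) (z a c : C) : cderiv f z a ->
  cderiv (fun w => c * f w)%C z (c * a)%C.
Proof.
  intros H. replace (c * a)%C with (0 * f z + c * a)%C by ring.
  apply (cderiv_mult (fun _ => c) f); auto. apply cderiv_const.
Qed.

Lemma cderiv_minus_const (f : C -> C) (z a c : C) : cderiv f z a ->
  cderiv (fun w => f w - c)%C z a.
Proof.
  intros H eps Heps. destruct (H eps Heps) as (d & Hd & Hk). exists d; split; auto.
  intros k Hkd. replace (f (z + k) - c - (f z - c) - a * k)%C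
    with (f (z + k) - f z - a * k)%C by ring. auto.
Qed.

Lemma Cmod_minus_ge (a b : C) : Cmod a - Cmod b <= Cmod (a - b)%C.
Proof.
  assert (H := Cmod_triangle (a - b)%C b). replace (a - b + b)%C with a in H by ring. lra.
Qed.

Lemma Cmod_pos_neq (z : C) : 0 < Cmod z -> z <> 0.
Proof. intros H. now apply Cmod_gt_0. Qed.

(** The remainder equals k^2 / (D^2 (D - k)) exactly, and |D - k| >= d / 2. *)
Lemma kernel1_estimate (D k : C) (d : R) : 0 < d -> d <= Cmod D -> Cmod k < d / 2 ->
  Cmod (/ (D - k) - / D - k / (D * D))%C <= 2 / d ^ 3 * Cmod k ^ 2.
Proof.
  intros Hd HD Hk.
  assert (HDk := Cmod_minus_ge D k). assert (Hd2 : d / 2 <= Cmod (D - k)%C) by lra.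
  assert (N1 : D <> 0) by (apply Cmod_pos_neq; lra).
  assert (N2 : (D - k)%C <> 0) by (apply Cmod_pos_neq; lra).
  replace (/ (D - k) - / D - k / (D * D))%C with ((k * k) * / (D * D * (D - k)))%C
    by (field; auto).
  rewrite Cmod_mult, Cmod_inv by (repeat apply Cmult_neq_0; auto). rewrite !Cmod_mult.
  replace (2 / d ^ 3 * Cmod k ^ 2) with (Cmod k * Cmod k * / (d * d * (d / 2))) by (field; lra).
  apply Rmult_le_compat_l; [apply Rmult_le_pos; apply Cmod_ge_0|].
  apply Rinv_le_contravar.
  - repeat apply Rmult_lt_0_compat; lra.
  - repeat apply Rmult_le_compat; try lra. nra.
Qed.

(** The remainder equals (3 D - 2 k) k^2 / (D^3 (D - k)^2): the numerator is at most 4 M |k|^2 and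
    the denominator at least d^5 / 4. *)
Lemma kernel2_estimate (D k : C) (d M : R) : 0 < d -> d <= Cmod D <= M -> Cmod k < d / 2 ->
  Cmod (/ ((D - k) * (D - k)) - / (D * D) - 2 * k / (D * D * D))%C
    <= 16 * M / d ^ 5 * Cmod k ^ 2.
Proof.
  intros Hd HD Hk.
  assert (HDk := Cmod_minus_ge D k). assert (Hd2 : d / 2 <= Cmod (D - k)%C) by lra.
  assert (N1 : D <> 0) by (apply Cmod_pos_neq; lra).
  assert (N2 : (D - k)%C <> 0) by (apply Cmod_pos_neq; lra).
  replace (/ ((D - k) * (D - k)) - / (D * D) - 2 * k / (D * D * D))%C
    with (((3 * D - 2 * k) * (k * k)) * / (D * D * D * ((D - k) * (D - k))))%C
    by (field; auto).
  rewrite Cmod_mult, Cmod_inv by (repeat apply Cmult_neq_0; auto). rewrite !Cmod_mult.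
  replace (16 * M / d ^ 5 * Cmod k ^ 2)
    with ((4 * M) * (Cmod k * Cmod k) * / (d * d * d * (d / 2 * (d / 2)))) by (field; lra).
  assert (Pk := Cmod_ge_0 k).
  assert (T : Cmod (3 * D - 2 * k)%C <= 4 * M).
  { replace (3 * D - 2 * k)%C with (3 * D + (- (2)) * k)%C by ring.
    eapply Rle_trans; [apply Cmod_triangle|]. rewrite !Cmod_mult, Cmod_opp, !Cmod_R.
    rewrite !Rabs_right by lra. lra. }
  apply Rmult_le_compat.
  - apply Rmult_le_pos; [apply Cmod_ge_0|nra].
  - apply Rlt_le, Rinv_0_lt_compat. repeat apply Rmult_lt_0_compat; lra.
  - apply Rmult_le_compat_r; [nra|auto].
  - apply Rinv_le_contravar.
    + repeat apply Rmult_lt_0_compat; lra.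
    + repeat apply Rmult_le_compat; try lra; nra.
Qed.

Lemma cderiv_inv_shift (w z : C) : z <> w ->
  cderiv (fun s => / (s - w))%C z (- / ((z - w) * (z - w)))%C.
Proof.
  intros H.
  assert (N : (z - w)%C <> 0).
  { intros E. apply H. replace z with ((z - w) + w)%C by ring. rewrite E. ring. }
  apply Cmod_gt_0 in N.
  apply (cderiv_quadratic _ _ _ (Cmod (z - w) / 2) (2 / Cmod (z - w) ^ 3)); [lra|].
  intros k Hk.
  assert (G := kernel1_estimate (z - w)%C (- k)%C (Cmod (z - w)%C) N (Rle_refl _)).
  rewrite Cmod_opp in G. eapply Rle_trans; [|apply G; exact Hk].
  apply Req_le. f_equal. replace (z - w - - k)%C with (z + k - w)%C by ring.
  unfold Cdiv. ring.
Qed.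

(** * Integrals over circles *)


Definition ccont (g : R -> C) (t : R) : Prop :=
  continuous (fun s => fst (g s)) t /\ continuous (fun s => snd (g s)) t.

Definition CInt (g : R -> C) (a b : R) : C :=
  (RInt (fun t => fst (g t)) a b, RInt (fun t => snd (g t)) a b).

Lemma continuous_Rmult (f g : R -> R) (t : R) :
  continuous f t -> continuous g t -> continuous (fun s => f s * g s) t.
Proof. intros Hf Hg. exact (continuous_mult (K := R_AbsRing) f g t Hf Hg). Qed.

Lemma continuous_Rplus (f g : R -> R) (t : R) :
  continuous f t -> continuous g t -> continuous (fun s => f s + g s) t.
Proof. intros Hf Hg. exact (continuous_plus (V := R_NormedModule) f g t Hf Hg). Qed.

Lemma continuous_Rminus (f g : R -> R) (t : R) :
  continuous f t -> continuous g t -> continuous (fun s => f s - g s) t.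
Proof. intros Hf Hg. exact (continuous_minus (V := R_NormedModule) f g t Hf Hg). Qed.

Lemma ccont_const (c : C) (t : R) : ccont (fun _ => c) t.
Proof. split; apply continuous_const. Qed.

Lemma ccont_minus (f g : R -> C) (t : R) :
  ccont f t -> ccont g t -> ccont (fun s => f s - g s)%C t.
Proof. intros [A B] [D E]. split; now apply continuous_Rminus. Qed.

Lemma ccont_mult (f g : R -> C) (t : R) :
  ccont f t -> ccont g t -> ccont (fun s => f s * g s)%C t.
Proof.
  intros [A B] [D E]. split; simpl.
  - apply continuous_Rminus; now apply continuous_Rmult.
  - apply continuous_Rplus; now apply continuous_Rmult.
Qed.

Lemma ccont_inv (f : R -> C) (t : R) : f t <> 0 -> ccont f t -> ccont (fun s => / f s)%C t.
Proof.
  intros N [A B].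
  assert (X : continuous (fun s => / (fst (f s) ^ 2 + snd (f s) ^ 2)) t).
  { apply continuity_pt_filterlim, continuity_pt_inv.
    - apply continuity_pt_filterlim. apply continuous_Rplus; simpl;
        repeat apply continuous_Rmult; auto; apply continuous_const.
    - rewrite <- Cmod_sqr. apply Cmod_gt_0 in N. apply pow_nonzero. lra. }
  split; simpl; apply continuous_Rmult; auto.
  apply (continuous_opp (V := R_NormedModule)). auto.
Qed.

Lemma ccont_ex_RInt (g : R -> C) (a b : R) : a <= b ->
  (forall t, a <= t <= b -> ccont g t) ->
  ex_RInt (fun t => fst (g t)) a b /\ ex_RInt (fun t => snd (g t)) a b.
Proof.
  intros Hab H. split; apply (ex_RInt_continuous (V := R_CompleteNormedModule));
    intros t Ht; rewrite Rmin_left, Rmax_right in Ht by lra; now apply H.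
Qed.

Lemma ccont_bounded (g : R -> C) (a b : R) :
  (forall t, a <= t <= b -> ccont g t) ->
  exists M, 0 <= M /\ forall t, a <= t <= b -> Cmod (g t) <= M.
Proof.
  intros H.
  destruct (bounded_continuity (V := R_NormedModule) (fun t => fst (g t)) a b) as [M1 H1].
  { intros t Ht. now apply H. }
  destruct (bounded_continuity (V := R_NormedModule) (fun t => snd (g t)) a b) as [M2 H2].
  { intros t Ht. now apply H. }
  exists (Rabs M1 + Rabs M2). assert (A1 := Rle_abs M1). assert (A2 := Rle_abs M2).
  split; [assert (X := Rabs_pos M1); assert (Y := Rabs_pos M2); lra|].
  intros t Ht. specialize (H1 t Ht). specialize (H2 t Ht).
  unfold norm in H1, H2; simpl in H1, H2; unfold abs in H1, H2; simpl in H1, H2.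
  eapply Rle_trans; [apply Cmod_le_sum|]. lra.
Qed.

Lemma CInt_ext (f g : R -> C) (a b : R) : (forall t, f t = g t) -> CInt f a b = CInt g a b.
Proof. intros H. unfold CInt. f_equal; apply RInt_ext; intros t _; now rewrite H. Qed.

Lemma CInt_minus (f g : R -> C) (a b : R) : a <= b ->
  (forall t, a <= t <= b -> ccont f t) -> (forall t, a <= t <= b -> ccont g t) ->
  CInt (fun t => f t - g t)%C a b = (CInt f a b - CInt g a b)%C.
Proof.
  intros Hab Hf Hg. apply ccont_ex_RInt in Hf; auto. apply ccont_ex_RInt in Hg; auto.
  unfold CInt, Cminus, Cplus, Copp; simpl. f_equal; apply RInt_Rminus; tauto.
Qed.

Lemma RInt_lincomb (f g : R -> R) (a b p q : R) : ex_RInt f a b -> ex_RInt g a b ->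
  RInt (fun t => p * f t + q * g t) a b = p * RInt f a b + q * RInt g a b.
Proof.
  intros Hf Hg. apply (is_RInt_unique (V := R_CompleteNormedModule)).
  apply (is_RInt_plus (V := R_NormedModule) (fun t => p * f t) (fun t => q * g t));
    apply (is_RInt_scal (V := R_NormedModule));
    now apply (RInt_correct (V := R_CompleteNormedModule)).
Qed.

Lemma CInt_scal (c : C) (f : R -> C) (a b : R) : a <= b ->
  (forall t, a <= t <= b -> ccont f t) ->
  CInt (fun t => c * f t)%C a b = (c * CInt f a b)%C.
Proof.
  intros Hab Hf. apply ccont_ex_RInt in Hf; auto. destruct Hf as [H1 H2].
  unfold CInt, Cmult; simpl. f_equal.
  - replace (_ - _) with (fst c * RInt (fun t => fst (f t)) a b +
      - snd c * RInt (fun t => snd (f t)) a b) by ring.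
    rewrite <- RInt_lincomb; auto. apply RInt_ext. intros t _. simpl. ring.
  - apply RInt_lincomb; auto.
Qed.

(** The factor 2 comes from estimating the two components separately; a crude constant is enough for
    derivatives. *)
Lemma CInt_bound (g : R -> C) (a b M : R) : a <= b ->
  (forall t, a <= t <= b -> ccont g t) ->
  (forall t, a <= t <= b -> Cmod (g t) <= M) -> Cmod (CInt g a b) <= 2 * (b - a) * M.
Proof.
  intros Hab Hg HM. apply ccont_ex_RInt in Hg; auto. destruct Hg as [H1 H2].
  eapply Rle_trans; [apply Cmod_le_sum|]. simpl.
  assert (A : Rabs (RInt (fun t => fst (g t)) a b) <= (b - a) * M).
  { apply abs_RInt_le_const; auto. intros t Ht.
    eapply Rle_trans; [apply Rabs_fst_le_Cmod | auto]. }
  assert (B : Rabs (RInt (fun t => snd (g t)) a b) <= (b - a) * M).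
  { apply abs_RInt_le_const; auto. intros t Ht.
    eapply Rle_trans; [apply Rabs_snd_le_Cmod | auto]. }
  lra.
Qed.

(** Differentiation under the integral with no limit theorem: a quadratic remainder that is uniform
    in [t] is integrated as it stands. *)
Lemma cderiv_CInt (K : C -> R -> C) (K' h : R -> C) (w : C) (a b r M : R) :
  a <= b -> 0 < r ->
  (forall t, a <= t <= b -> ccont h t /\ ccont K' t) ->
  (forall k t, Cmod k < r -> a <= t <= b -> ccont (K (w + k)%C) t) ->
  (forall k t, Cmod k < r -> a <= t <= b ->
     Cmod (K (w + k) t - K w t - k * K' t)%C <= M * Cmod k ^ 2) ->
  cderiv (fun z => CInt (fun t => h t * K z t)%C a b) w (CInt (fun t => h t * K' t)%C a b).
Proof.
  intros Hab Hr Hc HK HM.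
  destruct (ccont_bounded h a b) as (H & PH & HH); [intros t Ht; now apply Hc|].
  assert (K0 : forall t, a <= t <= b -> ccont (K w) t).
  { intros t Ht. assert (X := HK (RtoC 0) t). rewrite Cmod_0, Cplus_0_r in X. auto. }
  apply (cderiv_quadratic _ _ _ r (2 * (b - a) * (H * M)) Hr).
  intros k Hk.
  rewrite (Cmult_comm (CInt _ a b) k), <- CInt_scal; auto.
  2:{ intros t Ht. apply ccont_mult; now apply Hc. }
  rewrite <- CInt_minus; auto.
  2:{ intros t Ht. apply ccont_mult; [now apply Hc | now apply HK]. }
  2:{ intros t Ht. apply ccont_mult; [now apply Hc | now apply K0]. }
  rewrite <- CInt_minus; auto.
  2:{ intros t Ht. apply ccont_minus; apply ccont_mult; auto; now apply Hc. }
  2:{ intros t Ht. apply ccont_mult; [apply ccont_const|]. apply ccont_mult; now apply Hc. }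
  rewrite Rmult_assoc. apply CInt_bound; auto.
  - intros t Ht. apply ccont_minus.
    + apply ccont_minus; apply ccont_mult; auto; now apply Hc.
    + apply ccont_mult; [apply ccont_const|]. apply ccont_mult; now apply Hc.
  - intros t Ht.
    replace (h t * K (w + k) t - h t * K w t - k * (h t * K' t))%C
      with (h t * (K (w + k) t - K w t - k * K' t))%C by ring.
    rewrite Cmod_mult, Rmult_assoc.
    apply Rmult_le_compat; auto using Cmod_ge_0.
Qed.

Definition circle (a : C) (r t : R) : C := (fst a + r * cos t, snd a + r * sin t).
Definition dcircle (r t : R) : C := (- (r * sin t), r * cos t).

Lemma Cmod_circle (a : C) (r t : R) : 0 <= r -> Cmod (circle a r t - a)%C = r.
Proof.
  intros Hr. apply Rle_antisym; apply Rle_of_sqr; auto using Cmod_ge_0;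
    rewrite Cmod_sqr; unfold circle; simpl; apply Req_le;
    assert (E := sin2_cos2 t); unfold Rsqr in E; nra.
Qed.

Lemma continuous_cos_sin (t : R) : continuous cos t /\ continuous sin t.
Proof.
  split; apply continuity_pt_filterlim; [apply continuity_cos | apply continuity_sin].
Qed.

Lemma ccont_circle (a : C) (r t : R) : ccont (circle a r) t.
Proof.
  destruct (continuous_cos_sin t). split; unfold circle; simpl; apply continuous_Rplus;
    try apply continuous_Rmult; auto; apply continuous_const.
Qed.

Lemma ccont_dcircle (r t : R) : ccont (dcircle r) t.
Proof.
  destruct (continuous_cos_sin t). split; unfold dcircle; simpl.
  - apply (continuous_opp (V := R_NormedModule)). apply continuous_Rmult; auto.
    apply continuous_const.
  - apply continuous_Rmult; auto. apply continuous_const.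
Qed.

(** [L1] and [L2] are potentials of the real and imaginary parts of f dw along the circle, and their
    increments over a full turn vanish. *)
Lemma circle_integral_exact (f : C -> C) (L1 L2 : R -> R -> R) (a : C) (r : R) :
  (forall t, let u := fst (circle a r t) in let v := snd (circle a r t) in
     differentiable_pt_lim L1 u v (fst (f (u, v))) (- snd (f (u, v))) /\
     differentiable_pt_lim L2 u v (snd (f (u, v))) (fst (f (u, v))) /\
     continuity_2d_pt (fun s t => fst (f (s, t))) u v /\
     continuity_2d_pt (fun s t => snd (f (s, t))) u v) ->
  CInt (fun t => f (circle a r t) * dcircle r t)%C 0 (2 * PI) = 0.
Proof.
  intros H. assert (PP := PI_RGT_0).
  set (g1 := fun t => fst a + r * cos t). set (g2 := fun t => snd a + r * sin t).
  set (g1' := fun t => - (r * sin t)). set (g2' := fun t => r * cos t).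
  assert (D1 : forall t, derivable_pt_lim g1 t (g1' t)).
  { intros t. apply is_derive_Reals. unfold g1, g1'. auto_derive; auto. ring. }
  assert (D2 : forall t, derivable_pt_lim g2 t (g2' t)).
  { intros t. apply is_derive_Reals. unfold g2, g2'. auto_derive; auto. ring. }
  assert (CC : forall t, continuous g1' t /\ continuous g2' t)
    by (intros t; exact (ccont_dcircle r t)).
  assert (E1 : g1 (2 * PI) = g1 0) by (unfold g1; rewrite cos_2PI, cos_0; reflexivity).
  assert (E2 : g2 (2 * PI) = g2 0) by (unfold g2; rewrite sin_2PI, sin_0; reflexivity).
  assert (I1 := path_integral_potential L1 (fun s t => fst (f (s, t)))
    (fun s t => - snd (f (s, t))) g1 g2 g1' g2' 0 (2 * PI) ltac:(lra)).
  assert (I2 := path_integral_potential L2 (fun s t => snd (f (s, t)))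
    (fun s t => fst (f (s, t))) g1 g2 g1' g2' 0 (2 * PI) ltac:(lra)).
  rewrite E1, E2, Rminus_diag in I1, I2. unfold CInt, RtoC. f_equal;
    apply (is_RInt_unique (V := R_CompleteNormedModule)).
  - eapply (is_RInt_ext (V := R_NormedModule)); [|apply I1].
    + intros t _. simpl. unfold circle, g1, g2, g1', g2'. ring.
    + intros t _. destruct (H t) as (X1 & X2 & X3 & X4). destruct (CC t).
      repeat split; auto. now apply continuity_2d_pt_opp.
  - eapply (is_RInt_ext (V := R_NormedModule)); [|apply I2].
    + intros t _. simpl. unfold circle, g1, g2, g1', g2'. ring.
    + intros t _. destruct (H t) as (X1 & X2 & X3 & X4). destruct (CC t).
      repeat split; auto.
Qed.

(** Both components have zero differential along the segment from [a] to [w], which stays in the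
    disc. *)
Lemma cderiv_zero_const (g : C -> C) (a w : C) (r : R) :
  (forall z, Cmod (z - a)%C < r -> cderiv g z 0) -> Cmod (w - a)%C < r -> g w = g a.
Proof.
  intros H Hw.
  set (g1 := fun t => fst a + t * (fst w - fst a)).
  set (g2 := fun t => snd a + t * (snd w - snd a)).
  assert (Z : forall t, 0 <= t <= 1 -> cderiv g (g1 t, g2 t) 0).
  { intros t Ht. apply H.
    replace ((g1 t, g2 t) - a)%C with (RtoC t * (w - a))%C.
    - rewrite Cmod_mult, Cmod_R, Rabs_right by lra.
      assert (P := Cmod_ge_0 (w - a)%C). nra.
    - unfold g1, g2, RtoC, Cmult, Cminus, Cplus, Copp; simpl. f_equal; ring. }
  assert (Y : forall L : R -> R -> R,
     (forall t, 0 <= t <= 1 -> differentiable_pt_lim L (g1 t) (g2 t) 0 0) ->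
     L (fst w) (snd w) = L (fst a) (snd a)).
  { intros L HL.
    assert (I := path_integral_potential L (fun _ _ => 0) (fun _ _ => 0) g1 g2
      (fun _ => fst w - fst a) (fun _ => snd w - snd a) 0 1 ltac:(lra)).
    assert (I' : RInt.is_RInt (fun _ : R => 0) 0 1 (L (g1 1) (g2 1) - L (g1 0) (g2 0))).
    { eapply (is_RInt_ext (V := R_NormedModule)); [|apply I].
      - intros t _. simpl. ring.
      - intros t Ht. repeat split; auto; try apply continuity_2d_pt_const;
          try apply continuous_const; apply is_derive_Reals; unfold g1, g2;
          auto_derive; auto; ring. }
    apply (is_RInt_unique (V := R_CompleteNormedModule)) in I'.
    rewrite RInt_const in I'. unfold scal in I'; simpl in I'; unfold mult in I'; simpl in I'.
    unfold g1, g2 in I'.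
    replace (fst a + 1 * (fst w - fst a)) with (fst w) in I' by ring.
    replace (snd a + 1 * (snd w - snd a)) with (snd w) in I' by ring.
    replace (fst a + 0 * (fst w - fst a)) with (fst a) in I' by ring.
    replace (snd a + 0 * (snd w - snd a)) with (snd a) in I' by ring. lra. }
  assert (Y1 := Y (fun s t => fst (g (s, t)))). assert (Y2 := Y (fun s t => snd (g (s, t)))).
  destruct w as [w1 w2], a as [a1 a2]; simpl in *.
  rewrite (surjective_pairing (g (w1, w2))), (surjective_pairing (g (a1, a2))).
  f_equal; [apply Y1 | apply Y2]; intros t Ht;
    destruct (cderiv_differentiable _ _ _ _ (Z t Ht)) as [A B]; simpl in A, B;
    rewrite ?Ropp_0 in A; auto.
Qed.

Lemma circle_minus_neq (a w : C) (r t : R) : 0 <= r -> Cmod (w - a)%C < r ->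
  circle a r t <> w.
Proof. intros Hr Hw E. assert (X := Cmod_circle a r t Hr). rewrite E in X. lra. Qed.

Lemma circle_dist (a w : C) (r t : R) : 0 <= r ->
  r - Cmod (w - a)%C <= Cmod (circle a r t - w)%C.
Proof.
  intros Hr. rewrite <- (Cmod_circle a r t Hr) at 1.
  replace (circle a r t - w)%C with ((circle a r t - a) - (w - a))%C by ring.
  apply Cmod_minus_ge.
Qed.

Lemma ccont_kernel (a w : C) (r t : R) : 0 <= r -> Cmod (w - a)%C < r ->
  ccont (fun s => / (circle a r s - w))%C t.
Proof.
  intros Hr Hw. apply ccont_inv.
  - apply Cmod_pos_neq. assert (X := circle_dist a w r t Hr). lra.
  - apply ccont_minus; [apply ccont_circle | apply ccont_const].
Qed.

Lemma Cmod_shift (a w k : C) (r : R) :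
  Cmod (w - a)%C < r -> Cmod k < (r - Cmod (w - a)%C) / 2 -> Cmod (w + k - a)%C < r.
Proof.
  intros Hw Hk. replace (w + k - a)%C with ((w - a) + k)%C by ring.
  eapply Rle_lt_trans; [apply Cmod_triangle|]. lra.
Qed.

Lemma cauchy_kernel_derive1 (a w : C) (r : R) (h : R -> C) :
  0 <= r -> Cmod (w - a)%C < r -> (forall t, ccont h t) ->
  cderiv (fun z => CInt (fun t => h t * / (circle a r t - z))%C 0 (2 * PI)) w
    (CInt (fun t => h t * / ((circle a r t - w) * (circle a r t - w)))%C 0 (2 * PI)).
Proof.
  intros Hr Hw Hh. assert (PP := PI_RGT_0). set (d := r - Cmod (w - a)%C).
  assert (Pd : 0 < d) by (unfold d; lra).
  apply (cderiv_CInt (fun z t => / (circle a r t - z))%C _ h w 0 (2 * PI) (d / 2) (2 / d ^ 3));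
    try lra.
  - intros t _. split; auto. apply ccont_inv.
    + apply Cmult_neq_0; apply Cmod_pos_neq; assert (X := circle_dist a w r t Hr); lra.
    + apply ccont_mult; (apply ccont_minus; [apply ccont_circle | apply ccont_const]).
  - intros k t Hk _. apply ccont_kernel; auto. apply Cmod_shift; auto.
  - intros k t Hk _.
    assert (X := kernel1_estimate (circle a r t - w)%C k d Pd (circle_dist a w r t Hr) Hk).
    eapply Rle_trans; [|exact X]. apply Req_le. f_equal.
    replace (circle a r t - (w + k))%C with (circle a r t - w - k)%C by ring. reflexivity.
Qed.

Lemma cauchy_kernel_derive2 (a w : C) (r : R) (h : R -> C) :
  0 <= r -> Cmod (w - a)%C < r -> (forall t, ccont h t) ->
  cderiv (fun z => CInt (fun t => h t * / ((circle a r t - z) * (circle a r t - z)))%C 0 (2 * PI))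
    w (CInt (fun t => h t *
         (2 * / ((circle a r t - w) * (circle a r t - w) * (circle a r t - w))))%C
         0 (2 * PI)).
Proof.
  intros Hr Hw Hh. assert (PP := PI_RGT_0). set (d := r - Cmod (w - a)%C).
  assert (Pd : 0 < d) by (unfold d; lra).
  (* The second kernel estimate also needs an upper bound for |s - w| on the circle; this is 2 r. *)
  apply (cderiv_CInt (fun z t => / ((circle a r t - z) * (circle a r t - z)))%C _ h w 0 (2 * PI)
    (d / 2) (16 * (2 * r) / d ^ 5)); try lra.
  - intros t _. split; auto. apply ccont_mult; [apply ccont_const|]. apply ccont_inv.
    + repeat apply Cmult_neq_0; apply Cmod_pos_neq; assert (X := circle_dist a w r t Hr); lra.
    + repeat apply ccont_mult; (apply ccont_minus; [apply ccont_circle | apply ccont_const]).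
  - intros k t Hk _. apply ccont_inv.
    + assert (X := circle_dist a (w + k)%C r t Hr). assert (Y := Cmod_shift a w k r Hw Hk).
      apply Cmult_neq_0; apply Cmod_pos_neq; lra.
    + apply ccont_mult; (apply ccont_minus; [apply ccont_circle | apply ccont_const]).
  - intros k t Hk _.
    assert (B : Cmod (circle a r t - w)%C <= 2 * r).
    { replace (circle a r t - w)%C with ((circle a r t - a) + - (w - a))%C by ring.
      eapply Rle_trans; [apply Cmod_triangle|]. rewrite Cmod_opp, Cmod_circle; lra. }
    assert (X := kernel2_estimate (circle a r t - w)%C k d (2 * r) Pd
      (conj (circle_dist a w r t Hr) B) Hk).
    eapply Rle_trans; [|exact X]. apply Req_le. f_equal.
    replace (circle a r t - (w + k))%C with (circle a r t - w - k)%C by ring.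
    unfold Cdiv. ring.
Qed.

(** The value does not depend on [w] in the disc, because its derivative in [w] is the circle
    integral of 1 / (s - w)^2, which has the primitive -1 / (s - w). At the centre the integrand is
    the constant i. *)
Lemma circle_integral_inv (a w : C) (r : R) : 0 < r -> Cmod (w - a)%C < r ->
  CInt (fun t => dcircle r t * / (circle a r t - w))%C 0 (2 * PI) = (0, 2 * PI).
Proof.
  intros Hr Hw. assert (PP := PI_RGT_0).
  rewrite (cderiv_zero_const
    (fun z => CInt (fun t => dcircle r t * / (circle a r t - z))%C 0 (2 * PI)) a w r); auto.
  - unfold CInt. f_equal.
    + rewrite (RInt_ext (V := R_CompleteNormedModule) _ (fun _ => 0)).
      * rewrite RInt_const. unfold scal; simpl; unfold mult; simpl. ring.
      * intros t _. unfold circle, dcircle. simpl.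
        assert (E := sin2_cos2 t). unfold Rsqr in E. field_simplify_eq; [ring|]. nra.
    + rewrite (RInt_ext (V := R_CompleteNormedModule) _ (fun _ => 1)).
      * rewrite RInt_const. unfold scal; simpl; unfold mult; simpl. ring.
      * intros t _. unfold circle, dcircle. simpl.
        assert (E := sin2_cos2 t). unfold Rsqr in E. field_simplify_eq; [ring|]. nra.
  - intros z Hz.
    assert (D := cauchy_kernel_derive1 a z r (dcircle r) (Rlt_le _ _ Hr) Hz (ccont_dcircle r)).
    replace (RtoC 0) with
      (CInt (fun t => dcircle r t * / ((circle a r t - z) * (circle a r t - z)))%C 0 (2 * PI));
      auto.
    set (F := fun s => (- (1) * / (s - z))%C).
    set (f := fun s => (/ ((s - z) * (s - z)))%C).
    rewrite (CInt_ext _ (fun t => f (circle a r t) * dcircle r t)%C)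
      by (intros t; unfold f; ring).
    apply (circle_integral_exact f (fun s t => fst (F (s, t))) (fun s t => snd (F (s, t)))).
    intros t. simpl.
    assert (N := circle_minus_neq a z r t (Rlt_le _ _ Hr) Hz).
    assert (D0 := cderiv_inv_shift z (circle a r t) N).
    assert (DF : cderiv F (circle a r t) (f (circle a r t))).
    { replace (f (circle a r t))
        with (- (1) * (- / ((circle a r t - z) * (circle a r t - z))))%C by (unfold f; ring).
      apply cderiv_scal. exact D0. }
    apply cderiv_differentiable in DF. destruct DF as [DF1 DF2].
    assert (N' : (circle a r t - z)%C <> 0).
    { apply Cmod_pos_neq. assert (X := circle_dist a z r t (Rlt_le _ _ Hr)). lra. }
    (* Continuity of [f] on the circle is read off from differentiability, [f] being near each of
       its points the product of two copies of 1 / (s - z). *)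
    assert (Df : exists c, cderiv f (circle a r t) c).
    { assert (M := cderiv_mult _ _ _ _ _ D0 D0).
      eexists. eapply (cderiv_ext_loc _ _ _ _ (Cmod (circle a r t - z)%C)); [|  |exact M].
      - now apply Cmod_gt_0.
      - intros k Hk. unfold f. assert (X := Cmod_minus_ge (circle a r t - z)%C (- k)%C).
        rewrite Cmod_opp in X.
        assert (Y : (circle a r t + k - z)%C <> 0).
        { apply Cmod_pos_neq.
          replace (circle a r t + k - z)%C with (circle a r t - z - - k)%C by ring. lra. }
        field. auto. }
    destruct Df as [c Df]. apply cderiv_continuity in Df. destruct Df as [C1 C2].
    repeat split; assumption.
Qed.

(** * Cauchy's formula *)


Definition pbox (a b r : R) (p : C) : Prop := box a b r (fst p) (snd p).

Lemma Cmod_pbox (a z : C) (r : R) : Cmod (z - a)%C < r -> pbox (fst a) (snd a) r z.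
Proof.
  intros H. split; (eapply Rle_lt_trans; [|exact H]).
  - apply (Rabs_fst_le_Cmod (z - a)%C).
  - apply (Rabs_snd_le_Cmod (z - a)%C).
Qed.

Lemma continuity_2d_pt_Cmod (g : C -> C) (u v : R) :
  (forall eps, 0 < eps -> exists d, 0 < d /\ forall k, Cmod k < d ->
     Cmod (g ((u, v) + k) - g (u, v))%C <= eps) ->
  continuity_2d_pt (fun s t => fst (g (s, t))) u v /\
  continuity_2d_pt (fun s t => snd (g (s, t))) u v.
Proof.
  intros H.
  assert (G : forall eps : posreal, exists d : posreal, forall s t,
    Rabs (s - u) < d -> Rabs (t - v) < d -> Cmod (g (s, t) - g (u, v))%C < eps).
  { intros eps. assert (P := cond_pos eps).
    destruct (H (eps / 2) ltac:(lra)) as (d & Hd & Hk).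
    exists (mkposreal (d / 2) ltac:(lra)). simpl. intros s t Hs Ht.
    assert (M := Cmod_le_sum (s - u, t - v)). simpl in M.
    assert (K := Hk (s - u, t - v) ltac:(lra)).
    replace ((u, v) + (s - u, t - v)%R)%C with (s, t) in K
      by (unfold Cplus; simpl; f_equal; ring). lra. }
  split; intros eps; destruct (G eps) as [d Hd]; exists d; intros s t Hs Ht;
    (eapply Rle_lt_trans; [|apply (Hd s t Hs Ht)]).
  - apply (Rabs_fst_le_Cmod (g (s, t) - g (u, v))%C).
  - apply (Rabs_snd_le_Cmod (g (s, t) - g (u, v))%C).
Qed.

(** With [c] the derivative at [w] the singularity is filled continuously; this is the exceptional
    point for which the box potentials make allowance. *)
Definition diff_quotient (f : C -> C) (w c z : C) : C :=
  if excluded_middle_informative (z = w) then c else ((f z - f w) * / (z - w))%C.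

Lemma diff_quotient_continuous (f : C -> C) (u v : R) (c : C) : cderiv f (u, v) c ->
  continuity_2d_pt (fun s t => fst (diff_quotient f (u, v) c (s, t))) u v /\
  continuity_2d_pt (fun s t => snd (diff_quotient f (u, v) c (s, t))) u v.
Proof.
  intros H. apply continuity_2d_pt_Cmod. intros eps Heps.
  destruct (H eps Heps) as (d & Hd & Hk). exists d. split; auto. intros k Hkd.
  replace (diff_quotient f (u, v) c (u, v)) with c
    by (unfold diff_quotient; destruct excluded_middle_informative; congruence).
  unfold diff_quotient.
  destruct excluded_middle_informative as [E|E].
  - replace (c - c)%C with (RtoC 0) by ring. rewrite Cmod_0. lra.
  - assert (N : k <> 0) by (intros ->; apply E; apply Cplus_0_r).
    replace ((u, v) + k - (u, v))%C with k by ring.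
    replace ((f ((u, v) + k) - f (u, v)) * / k - c)%C
      with ((f ((u, v) + k) - f (u, v) - c * k) * / k)%C by (field; auto).
    rewrite Cmod_mult, Cmod_inv by auto. specialize (Hk k Hkd).
    apply Cmod_gt_0 in N. apply Rmult_le_reg_r with (Cmod k); auto.
    rewrite Rmult_assoc, Rinv_l by lra. lra.
Qed.

Lemma diff_quotient_cderiv (f : C -> C) (w c z : C) : z <> w ->
  (exists b, cderiv f z b) -> exists b, cderiv (diff_quotient f w c) z b.
Proof.
  intros N [b Hb].
  assert (M := cderiv_mult _ _ _ _ _ (cderiv_minus_const f z b (f w) Hb)
                 (cderiv_inv_shift w z N)).
  assert (N' : (z - w)%C <> 0).
  { intros E. apply N. replace z with ((z - w) + w)%C by ring. rewrite E. ring. }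
  apply Cmod_gt_0 in N'.
  eexists. eapply (cderiv_ext_loc _ _ _ _ (Cmod (z - w)%C)); [exact N'| |exact M].
  intros k Hk. unfold diff_quotient.
  destruct excluded_middle_informative as [E|E]; auto. exfalso.
  assert (X := Cmod_minus_ge (z - w)%C (- k)%C). rewrite Cmod_opp in X.
  replace (z - w - - k)%C with (z + k - w)%C in X by ring.
  rewrite E in X. replace (w - w)%C with (RtoC 0) in X by ring. rewrite Cmod_0 in X. lra.
Qed.

Lemma ccont_comp_circle (f : C -> C) (a : C) (r t : R) :
  (exists c, cderiv f (circle a r t) c) -> ccont (fun s => f (circle a r s)) t.
Proof.
  intros [c Hc]. destruct (ccont_circle a r t) as [C1 C2].
  destruct (cderiv_continuity _ _ _ _ Hc) as [D1 D2]. split.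
  - exact (continuous_comp_2d _ (fun s => fst (circle a r s)) (fun s => snd (circle a r s))
             t D1 C1 C2).
  - exact (continuous_comp_2d _ (fun s => fst (circle a r s)) (fun s => snd (circle a r s))
             t D2 C1 C2).
Qed.

(** Splitting the vanishing circle integral of the difference quotient leaves f(w) times the winding
    integral 2 pi i. The bound r < r' places the whole circle in the box on which the potentials
    live. *)
Lemma cauchy_formula (f : C -> C) (a w : C) (r r' : R) :
  0 < r < r' -> (forall z, pbox (fst a) (snd a) r' z -> exists c, cderiv f z c) ->
  Cmod (w - a)%C < r ->
  ((0, 2 * PI)%R * f w)%C =
    CInt (fun t => f (circle a r t) * dcircle r t * / (circle a r t - w))%C 0 (2 * PI).
Proof.
  intros Hr Hf Hw. assert (PP := PI_RGT_0).
  assert (Hw' : pbox (fst a) (snd a) r' w) by (apply Cmod_pbox; lra).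
  destruct (Hf w Hw') as [c Hc]. set (q := diff_quotient f w c).
  assert (Cq : forall u v, pbox (fst a) (snd a) r' (u, v) ->
     continuity_2d_pt (fun s t => fst (q (s, t))) u v /\
     continuity_2d_pt (fun s t => snd (q (s, t))) u v).
  { intros u v Huv. destruct (excluded_middle_informative ((u, v) = w)) as [E|E].
    - unfold q. rewrite <- E in Hc |- *. now apply diff_quotient_continuous.
    - destruct (diff_quotient_cderiv f w c (u, v) E (Hf _ Huv)) as [b Hb].
      now apply cderiv_continuity in Hb. }
  assert (Dq : forall u v, pbox (fst a) (snd a) r' (u, v) -> (u, v) <> (fst w, snd w) ->
     exists b, cderiv q (u, v) b).
  { intros u v Huv N. apply diff_quotient_cderiv; auto. now rewrite <- surjective_pairing in N. }
  destruct (local_potential_except (fun s t => fst (q (s, t))) (fun s t => - snd (q (s, t)))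
    (fst a) (snd a) r' (fst w) (snd w)) as [L1 H1].
  { intros u v Huv. destruct (Cq u v Huv). split; auto. now apply continuity_2d_pt_opp. }
  { intros u v Huv N. destruct (Dq u v Huv N) as [b Hb]. now apply cderiv_closed in Hb. }
  destruct (local_potential_except (fun s t => snd (q (s, t))) (fun s t => fst (q (s, t)))
    (fst a) (snd a) r' (fst w) (snd w)) as [L2 H2].
  { intros u v Huv. destruct (Cq u v Huv). split; auto. }
  { intros u v Huv N. destruct (Dq u v Huv N) as [b Hb]. now apply cderiv_closed in Hb. }
  assert (Hc' : forall t, pbox (fst a) (snd a) r' (circle a r t)).
  { intros t. apply Cmod_pbox. rewrite Cmod_circle; lra. }
  assert (Z : CInt (fun t => q (circle a r t) * dcircle r t)%C 0 (2 * PI) = 0).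
  { apply (circle_integral_exact q L1 L2). intros t. simpl.
    assert (B := Hc' t). destruct (Cq _ _ B). repeat split; auto. }
  assert (CK : forall t, ccont (fun s => dcircle r s * / (circle a r s - w))%C t).
  { intros t. apply ccont_mult; [apply ccont_dcircle|]. apply ccont_kernel; lra. }
  rewrite (CInt_ext _ (fun t => f (circle a r t) * dcircle r t * / (circle a r t - w)
    - f w * (dcircle r t * / (circle a r t - w)))%C) in Z.
  - rewrite CInt_minus, CInt_scal, circle_integral_inv in Z; try lra.
    + replace (CInt _ _ _) with
        ((CInt (fun t => f (circle a r t) * dcircle r t * / (circle a r t - w)) 0 (2 * PI)
          - f w * (0, 2 * PI)%R) + f w * (0, 2 * PI)%R)%C by ring.
      rewrite Z. ring.
    + auto.
    + intros t _. apply ccont_mult; [|apply ccont_kernel; lra].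
      apply ccont_mult; [|apply ccont_dcircle]. apply ccont_comp_circle. auto.
    + intros t _. apply ccont_mult; auto. apply ccont_const.
  (* On the circle the quotient takes its second branch, since the circle misses [w]. *)
  - intros t. unfold q, diff_quotient.
    destruct excluded_middle_informative as [E|E].
    + exfalso. revert E. apply circle_minus_neq; lra.
    + ring.
Qed.

(** Differentiating Cauchy's formula gives [f'] as an explicit integral on a disc, and
    differentiating that integral gives a derivative of [f']. Its existence at the centre suffices,
    since every point of an open set is the centre of such a box. *)
Lemma cderiv_regular (f : C -> C) (a : C) (r : R) : 0 < r ->
  (forall z, pbox (fst a) (snd a) r z -> exists c, cderiv f z c) ->
  exists f', (forall w, Cmod (w - a)%C < r / 2 -> cderiv f w (f' w)) /\
    exists c, cderiv f' a c.
Proof.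
  intros Hr Hf. assert (PP := PI_RGT_0). set (s := r / 2).
  set (h := fun t => (f (circle a s t) * dcircle s t)%C).
  assert (Hs : 0 < s < r) by (unfold s; lra).
  assert (Hh : forall t, ccont h t).
  { intros t. apply ccont_mult; [|apply ccont_dcircle]. apply ccont_comp_circle.
    apply Hf. apply Cmod_pbox. rewrite Cmod_circle; lra. }
  assert (N : (0, 2 * PI) <> RtoC 0) by (intros E; inversion E; lra).
  set (f' := fun w => (/ (0, 2 * PI)%R *
    CInt (fun t => h t * / ((circle a s t - w) * (circle a s t - w))) 0 (2 * PI))%C).
  exists f'. split.
  - intros w Hw. unfold f'.
    eapply (cderiv_ext_loc _ _ _ _ ((s - Cmod (w - a)%C) / 2));
      [lra| |apply cderiv_scal; apply cauchy_kernel_derive1; auto; lra].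
    intros k Hk. cbv beta. unfold h. rewrite <- (cauchy_formula f a (w + k)%C s r Hs Hf).
    + field. exact N.
    + now apply Cmod_shift.
  - eexists. unfold f'. apply cderiv_scal. apply cauchy_kernel_derive2; auto; try lra.
    replace (a - a)%C with (RtoC 0) by ring. rewrite Cmod_0. lra.
Qed.

(** * Smoothness and harmonicity *)


Lemma sqr_lt_of_abs (a e : R) : Rabs a < e -> a ^ 2 < e ^ 2.
Proof. intros H. rewrite <- pow2_abs. assert (P := Rabs_pos a). nra. Qed.

Lemma open2_box (U : R -> R -> Prop) (u v : R) : open2 U -> U u v ->
  exists r : posreal, forall u' v', box u v r u' v' -> U u' v'.
Proof.
  intros HU Huv. destruct (HU u v Huv) as (r & Hr & H).
  exists (mkposreal (r / 2) ltac:(lra)). simpl. intros u' v' [H1 H2]. apply H.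
  apply sqr_lt_of_abs in H1. apply sqr_lt_of_abs in H2. nra.
Qed.

Lemma cont2_on_continuity_2d (U : R -> R -> Prop) (F : R -> R -> R) : open2 U ->
  (cont2_on U F <-> forall u v, U u v -> continuity_2d_pt F u v).
Proof.
  intros HU. split.
  - intros H u v Huv eps. destruct (H u v Huv eps (cond_pos eps)) as (d & Hd & Hk).
    destruct (open2_box U u v HU Huv) as [r Hr].
    assert (P : 0 < Rmin r (d / 2)) by (apply Rmin_pos; [apply cond_pos | lra]).
    exists (mkposreal _ P). simpl. intros s t Hs Ht.
    assert (M1 := Rmin_l r (d / 2)). assert (M2 := Rmin_r r (d / 2)).
    apply Hk.
    + apply Hr. split; lra.
    + assert (A1 := sqr_lt_of_abs (s - u) (d / 2) ltac:(lra)).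
      assert (A2 := sqr_lt_of_abs (t - v) (d / 2) ltac:(lra)). nra.
  - intros H u v Huv eps Heps. destruct (H u v Huv (mkposreal eps Heps)) as [d Hd].
    exists d. split; [apply cond_pos|]. intros s t _ Hst. simpl in Hd.
    assert (P := cond_pos d).
    assert (A1 := pow2_ge_0 (s - u)). assert (A2 := pow2_ge_0 (t - v)).
    apply Hd; (apply Rlt_of_sqr; [lra | rewrite pow2_abs; lra]).
Qed.

Lemma pdu_derivable (F : R -> R -> R) (u v l : R) :
  derivable_pt_lim (fun s => F s v) u l -> pdu F u v = l.
Proof.
  intros H. apply (uniqueness_limite (fun s => F s v) u); auto.
  exact (epsilon_spec (inhabits 0) (fun l => derivable_pt_lim (fun s => F s v) u l)
           (ex_intro _ l H)).
Qed.

Lemma pdv_derivable (F : R -> R -> R) (u v l : R) :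
  derivable_pt_lim (fun t => F u t) v l -> pdv F u v = l.
Proof.
  intros H. apply (uniqueness_limite (fun t => F u t) v); auto.
  exact (epsilon_spec (inhabits 0) (fun l => derivable_pt_lim (fun t => F u t) v l)
           (ex_intro _ l H)).
Qed.

Lemma derivable_pt_lim_ext_loc (f g : R -> R) (x l : R) :
  locally x (fun s => f s = g s) -> derivable_pt_lim f x l -> derivable_pt_lim g x l.
Proof.
  intros E H. apply is_derive_Reals. apply (is_derive_ext_loc f); auto.
  now apply is_derive_Reals.
Qed.

Lemma derivable_ext_open (U : R -> R -> Prop) (F G : R -> R -> R) (u v l : R) :
  open2 U -> (forall s t, U s t -> F s t = G s t) -> U u v ->
  (derivable_pt_lim (fun s => F s v) u l -> derivable_pt_lim (fun s => G s v) u l) /\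
  (derivable_pt_lim (fun t => F u t) v l -> derivable_pt_lim (fun t => G u t) v l).
Proof.
  intros HU E Huv. destruct (open2_box U u v HU Huv) as [r Hr]. assert (P := cond_pos r).
  split; apply derivable_pt_lim_ext_loc; exists r; intros s Hs; apply E, Hr;
    split; auto; rewrite Rminus_diag, Rabs_R0; auto.
Qed.

(** [pdu] and [pdv] choose from a predicate, so equal values come from equal predicates; the
    equality thereby holds even where no partial derivative exists. *)
Lemma pd_ext_open (U : R -> R -> Prop) (F G : R -> R -> R) (u v : R) :
  open2 U -> (forall s t, U s t -> F s t = G s t) -> U u v ->
  pdu F u v = pdu G u v /\ pdv F u v = pdv G u v.
Proof.
  intros HU E Huv.
  assert (E' : forall s t, U s t -> G s t = F s t) by (intros; symmetry; auto).
  unfold pdu, pdv. split; f_equal; apply functional_extensionality; intros l;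
    apply propositional_extensionality; split;
    apply (derivable_ext_open U); auto.
Qed.

(** Identities between partial derivatives are known on [U] only, so [Ck] must be insensitive to
    values outside it. *)
Lemma Ck_ext (k : nat) (U : R -> R -> Prop) (F G : R -> R -> R) :
  open2 U -> (forall s t, U s t -> F s t = G s t) -> Ck k U F -> Ck k U G.
Proof.
  intros HU. revert F G. induction k as [|k IH]; intros F G E H.
  - destruct H as [H _]. split; auto. intros u v Huv eps Heps.
    destruct (H u v Huv eps Heps) as (d & Hd & Hk). exists d. split; auto.
    intros s t Hst. rewrite <- !E; auto.
  - destruct H as (H0 & H1 & H2 & H3). split; [|split; [|split]].
    + intros u v Huv eps Heps.
      destruct (H0 u v Huv eps Heps) as (d & Hd & Hk). exists d. split; auto.
      intros s t Hst. rewrite <- !E; auto.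
    + intros u v Huv. destruct (H1 u v Huv) as [[l Hl] [m Hm]].
      split; [exists l | exists m]; eapply (derivable_ext_open U); eauto.
    + apply (IH (pdu F)); auto. intros s t Hst. now apply (pd_ext_open U).
    + apply (IH (pdv F)); auto. intros s t Hst. now apply (pd_ext_open U).
Qed.

Lemma Ck_derivable (k : nat) (U : R -> R -> Prop) (F : R -> R -> R) (u v : R) :
  Ck (S k) U F -> U u v ->
  derivable_pt_lim (fun s => F s v) u (pdu F u v) /\
  derivable_pt_lim (fun t => F u t) v (pdv F u v).
Proof.
  intros (_ & H & _) Huv. destruct (H u v Huv) as [[l Hl] [m Hm]].
  now rewrite (pdu_derivable F u v l Hl), (pdv_derivable F u v m Hm).
Qed.

Lemma differentiable_pt_lim_derivable (F : R -> R -> R) (u v a b : R) :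
  differentiable_pt_lim F u v a b ->
  derivable_pt_lim (fun s => F s v) u a /\ derivable_pt_lim (fun t => F u t) v b.
Proof.
  intros H. split.
  - replace a with (a * 1 + b * 0) by ring.
    apply (derivable_pt_lim_comp_2d F (fun s => s) (fun _ => v)); auto.
    + apply derivable_pt_lim_id.
    + apply derivable_pt_lim_const.
  - replace b with (a * 0 + b * 1) by ring.
    apply (derivable_pt_lim_comp_2d F (fun _ => u) (fun t => t)); auto.
    + apply derivable_pt_lim_const.
    + apply derivable_pt_lim_id.
Qed.

Lemma differentiable_pd (F : R -> R -> R) (u v a b : R) :
  differentiable_pt_lim F u v a b -> pdu F u v = a /\ pdv F u v = b.
Proof.
  intros H. apply differentiable_pt_lim_derivable in H. destruct H.
  split; [now apply pdu_derivable | now apply pdv_derivable].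
Qed.

(** By Cauchy-Riemann the real part alone determines the derivative, which gives a closed expression
    for it to iterate on. *)
Lemma cderiv_phi_of (phi : R -> R -> Cx) (u v : R) (c : C) :
  cderiv (uncurryC phi) (u, v) c -> c = phi_of (fun s t => fst (phi s t)) u v.
Proof.
  intros H. destruct (cderiv_differentiable _ _ _ _ H) as [H1 _].
  destruct (differentiable_pd _ _ _ _ _ H1) as [E1 E2].
  unfold phi_of. unfold uncurryC in E1, E2; simpl in E1, E2. rewrite E1, E2, Ropp_involutive.
  now destruct c.
Qed.

Lemma holomorphic_derivative (U : R -> R -> Prop) (phi : R -> R -> Cx) :
  open2 U -> holomorphic U phi -> holomorphic U (phi_of (fun s t => fst (phi s t))).
Proof.
  intros HU H. rewrite holomorphic_cderiv in H |- *. intros u v Huv.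
  destruct (open2_box U u v HU Huv) as [r Hr]. assert (P := cond_pos r).
  destruct (cderiv_regular (uncurryC phi) (u, v) r P) as (f' & H1 & c & H2).
  { intros [s t] Hz. apply H. now apply Hr. }
  exists c. apply (cderiv_ext_loc f' _ _ _ (r / 2)); [lra| |exact H2].
  intros k Hk. set (z := ((u, v) + k)%C).
  assert (Hz : Cmod (z - (u, v))%C < r / 2).
  { unfold z. now replace ((u, v) + k - (u, v))%C with k by ring. }
  specialize (H1 z Hz). destruct z as [s t]. unfold uncurryC at 1; simpl.
  now apply cderiv_phi_of.
Qed.

Lemma holomorphic_scal (U : R -> R -> Prop) (phi : R -> R -> Cx) (c : C) :
  holomorphic U phi -> holomorphic U (fun u v => Cmul c (phi u v)).
Proof.
  intros H. rewrite holomorphic_cderiv in H |- *. intros u v Huv.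
  destruct (H u v Huv) as [b Hb]. exists (c * b)%C. exact (cderiv_scal _ _ _ c Hb).
Qed.

(** The partials of Re phi are Re phi' and Re (i phi'), again real parts of holomorphic functions,
    so the induction closes on real parts. *)
Lemma holomorphic_fst_Ck (k : nat) (U : R -> R -> Prop) (phi : R -> R -> Cx) :
  open2 U -> holomorphic U phi -> Ck k U (fun u v => fst (phi u v)).
Proof.
  intros HU. revert phi. induction k as [|k IH]; intros phi H.
  - split; auto. apply cont2_on_continuity_2d; auto. intros u v Huv.
    rewrite holomorphic_cderiv in H. destruct (H u v Huv) as [c Hc].
    now apply cderiv_continuity in Hc.
  - assert (H' := holomorphic_derivative U phi HU H).
    split; [|split; [|split]].
    + apply cont2_on_continuity_2d; auto. intros u v Huv.
      rewrite holomorphic_cderiv in H. destruct (H u v Huv) as [c Hc].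
      now apply cderiv_continuity in Hc.
    + intros u v Huv. rewrite holomorphic_cderiv in H. destruct (H u v Huv) as [c Hc].
      apply cderiv_differentiable in Hc. destruct Hc as [Hc _].
      apply differentiable_pt_lim_derivable in Hc. destruct Hc. split; eexists; eassumption.
    + exact (IH _ H').
    + apply (Ck_ext k U (fun u v => fst (Cmul (0, 1)
        (phi_of (fun s t => fst (phi s t)) u v)))); auto.
      * intros s t _. unfold Cmul, phi_of; simpl. ring.
      * apply IH. now apply holomorphic_scal.
Qed.

(** That is, dL = Re (phi dw); the minus sign comes from i^2. *)
Definition is_potential (U : R -> R -> Prop) (L : R -> R -> R) (phi : R -> R -> Cx) : Prop :=
  forall u v, U u v -> differentiable_pt_lim L u v (fst (phi u v)) (- snd (phi u v)).

Lemma potential_phi_of (U : R -> R -> Prop) (L : R -> R -> R) (phi : R -> R -> Cx) (u v : R) :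
  is_potential U L phi -> U u v -> phi u v = phi_of L u v.
Proof.
  intros H Huv. destruct (differentiable_pd _ _ _ _ _ (H u v Huv)) as [E1 E2].
  unfold phi_of. rewrite E1, E2, Ropp_involutive. now destruct (phi u v).
Qed.

Lemma potential_smooth (U : R -> R -> Prop) (L : R -> R -> R) (phi : R -> R -> Cx) :
  open2 U -> holomorphic U phi -> is_potential U L phi -> smooth_on U L.
Proof.
  intros HU H HL k.
  assert (C0 : cont2_on U L).
  { apply cont2_on_continuity_2d; auto. intros u v Huv.
    apply differentiable_continuity_pt. do 2 eexists. now apply HL. }
  destruct k as [|k]; split; auto. split; [|split].
  - intros u v Huv. destruct (differentiable_pt_lim_derivable _ _ _ _ _ (HL u v Huv)).
    split; eexists; eassumption.
  - apply (Ck_ext k U (fun u v => fst (phi u v))); auto using holomorphic_fst_Ck.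
    intros s t Hst. rewrite (potential_phi_of U L phi s t HL Hst). reflexivity.
  - apply (Ck_ext k U (fun u v => fst (Cmul (0, 1) (phi u v)))); auto.
    + intros s t Hst. rewrite (potential_phi_of U L phi s t HL Hst).
      unfold Cmul, phi_of; simpl. ring.
    + apply holomorphic_fst_Ck; auto. now apply holomorphic_scal.
Qed.

Lemma potential_harmonic (U : R -> R -> Prop) (L : R -> R -> R) (phi : R -> R -> Cx) (u v : R) :
  open2 U -> holomorphic U phi -> is_potential U L phi -> U u v ->
  pdu (pdu L) u v + pdv (pdv L) u v = 0.
Proof.
  intros HU H HL Huv. rewrite holomorphic_cderiv in H. destruct (H u v Huv) as [c Hc].
  apply cderiv_differentiable in Hc. destruct Hc as [H1 H2].
  assert (E1 : forall s t, U s t -> pdu L s t = fst (phi s t)).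
  { intros s t Hst. now rewrite (potential_phi_of U L phi s t HL Hst). }
  assert (E2 : forall s t, U s t -> pdv L s t = - snd (phi s t)).
  { intros s t Hst. rewrite (potential_phi_of U L phi s t HL Hst). simpl. ring. }
  destruct (pd_ext_open U _ _ u v HU E1 Huv) as [F1 _].
  destruct (pd_ext_open U _ _ u v HU E2 Huv) as [_ F2]. rewrite F1, F2.
  apply differentiable_pt_lim_derivable in H1. apply differentiable_pt_lim_derivable in H2.
  destruct H1 as [H1 _], H2 as [_ H2]. unfold uncurryC in H1, H2; simpl in H1, H2.
  rewrite (pdu_derivable _ u v _ H1).
  rewrite (pdv_derivable (fun s t => - snd (phi s t)) u v (- fst c)).
  - ring.
  - now apply derivable_pt_lim_opp in H2.
Qed.

Lemma derivable_Derive (f : R -> R) (x l : R) : derivable_pt_lim f x l -> Derive f x = l.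
Proof. intros H. apply is_derive_unique. now apply is_derive_Reals. Qed.

(** [Schwarz] is phrased with [Derive], so the partials chosen by [epsilon] are first identified
    with it throughout [U]. *)
Lemma Ck_2_mixed (U : R -> R -> Prop) (F : R -> R -> R) (u v : R) :
  open2 U -> Ck 2 U F -> U u v -> pdu (pdv F) u v = pdv (pdu F) u v.
Proof.
  intros HU HF Huv. assert (HF' := HF). destruct HF' as (_ & _ & Hu & Hv).
  (* Continuity of [pdv (pdu F)] and of [pdu (pdv F)], unpacked from [Ck 2]. *)
  assert (HuC := proj1 (proj2 (proj2 (proj2 Hu)))).
  assert (HvC := proj1 (proj1 (proj2 (proj2 Hv)))).
  rewrite cont2_on_continuity_2d in HuC, HvC by auto.
  assert (A1 : forall s t, U s t -> Derive (fun z => F z t) s = pdu F s t).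
  { intros s t Hst. apply derivable_Derive. now apply (Ck_derivable 1 U). }
  assert (A2 : forall s t, U s t -> Derive (fun z => F s z) t = pdv F s t).
  { intros s t Hst. apply derivable_Derive. now apply (Ck_derivable 1 U). }
  assert (A1' : forall s t, U s t -> pdu F s t = Derive (fun z => F z t) s)
    by (intros; symmetry; auto).
  assert (A2' : forall s t, U s t -> pdv F s t = Derive (fun z => F s z) t)
    by (intros; symmetry; auto).
  assert (B1 : forall s t, U s t ->
    derivable_pt_lim (fun z => Derive (fun y => F y z) s) t (pdv (pdu F) s t)).
  { intros s t Hst.
    apply (derivable_ext_open U (pdu F) (fun s t => Derive (fun y => F y t) s)); auto.
    now apply (Ck_derivable 0 U). }
  assert (B2 : forall s t, U s t ->
    derivable_pt_lim (fun z => Derive (fun y => F z y) t) s (pdu (pdv F) s t)).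
  { intros s t Hst.
    apply (derivable_ext_open U (pdv F) (fun s t => Derive (fun y => F s y) t)); auto.
    now apply (Ck_derivable 0 U). }
  destruct (open2_box U u v HU Huv) as [r Hr].
  rewrite <- (derivable_Derive _ _ _ (B1 u v Huv)), <- (derivable_Derive _ _ _ (B2 u v Huv)).
  apply Schwarz.
  - exists r. intros s t Hs Ht. assert (Hst : U s t) by (apply Hr; split; auto).
    destruct (Ck_derivable 1 U F s t HF Hst).
    repeat split; eexists; apply is_derive_Reals; eauto.
  - apply (continuity_2d_pt_ext_loc (pdu (pdv F))); auto.
    exists r. intros s t Hs Ht. symmetry. apply derivable_Derive, B2, Hr. split; auto.
  - apply (continuity_2d_pt_ext_loc (pdv (pdu F))); auto.
    exists r. intros s t Hs Ht. symmetry. apply derivable_Derive, B1, Hr. split; auto.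
Qed.

Lemma Ck_1_differentiable (U : R -> R -> Prop) (F : R -> R -> R) (u v : R) :
  open2 U -> Ck 1 U F -> U u v -> differentiable_pt_lim F u v (pdu F u v) (pdv F u v).
Proof.
  intros HU HF Huv. apply differentiable_pt_lim_partials.
  - destruct (open2_box U u v HU Huv) as [r Hr]. exists r. intros s t Hs Ht.
    apply is_derive_Reals. apply (Ck_derivable 0 U); auto. apply Hr; split; auto.
  - apply is_derive_Reals. now apply (Ck_derivable 0 U).
  - destruct HF as (_ & _ & [HF _] & _). rewrite cont2_on_continuity_2d in HF; auto.
Qed.

(** Symmetry of the mixed partials is one Cauchy-Riemann equation for F_u - i F_v, harmonicity is
    the other. *)
Lemma harmonic_holomorphic (U : R -> R -> Prop) (F : R -> R -> R) :
  open2 U -> smooth_on U F ->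
  (forall u v, U u v -> pdu (pdu F) u v + pdv (pdv F) u v = 0) -> holomorphic U (phi_of F).
Proof.
  intros HU HF Hh. apply holomorphic_cderiv. intros u v Huv.
  assert (H2 := HF 2%nat). assert (M := Ck_2_mixed U F u v HU H2 Huv).
  destruct H2 as (_ & _ & Hu & Hv).
  exists (pdu (pdu F) u v, - pdv (pdu F) u v).
  assert (D1 := Ck_1_differentiable U _ u v HU Hu Huv).
  assert (D2 := Ck_1_differentiable U _ u v HU Hv Huv).
  specialize (Hh u v Huv). apply differentiable_cderiv; simpl.
  - now rewrite Ropp_involutive.
  - intros eps. destruct (D2 eps) as [d Hd]. exists d. intros s t Hs Ht.
    eapply Rle_trans; [|apply (Hd s t Hs Ht)]. apply Req_le. rewrite <- Rabs_Ropp.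
    f_equal. rewrite M. replace (pdu (pdu F) u v) with (- pdv (pdv F) u v) by lra. ring.
Qed.

(** In dimension two the Christoffel terms cancel in the trace: a conformal metric has Gamma^k_11 +
    Gamma^k_22 = 0 for each k, so the first derivatives of [z] drop out. *)
Lemma trace_h_isothermal (U : R -> R -> Prop) (x y z : R -> R -> R) (u v : R) :
  open2 U -> isothermal U x y z -> U u v -> 0 < gm x y false false u v ->
  trace_h x y z u v = (pdu (pdu z) u v + pdv (pdv z) u v) / gm x y false false u v.
Proof.
  intros HU Hi Huv HE.
  assert (Z : forall i, D i (fun _ _ => 0) u v = 0).
  { intros []; simpl; [apply (pdv_derivable (fun _ _ => 0)) | apply (pdu_derivable (fun _ _ => 0))];
      apply derivable_pt_lim_const. }
  assert (E1 : forall i, D i (gm x y true true) u v = D i (gm x y false false) u v).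
  { intros []; simpl; apply (pd_ext_open U); auto; intros s t Hst; symmetry; now apply Hi. }
  assert (E2 : forall i, D i (gm x y false true) u v = 0).
  { intros i. rewrite <- (Z i). destruct i; simpl; apply (pd_ext_open U); auto;
      intros s t Hst; now apply Hi. }
  assert (E3 : forall i, D i (gm x y true false) u v = 0).
  { intros i. rewrite <- (Z i). destruct i; simpl; apply (pd_ext_open U); auto;
      intros s t Hst; rewrite <- (proj2 (Hi s t Hst)); unfold gm; ring. }
  destruct (Hi u v Huv) as [F1 F2].
  unfold trace_h, hff, Gamma, sumb, ginv, detg.
  rewrite !E1, !E2, !E3, F2, <- F1. simpl (D false _). simpl (D true _).
  field. lra.
Qed.

Lemma pdu_sum_prod (A B A' B' : R -> R -> R) (u v a b a' b' : R) :
  derivable_pt_lim (fun s => A s v) u a -> derivable_pt_lim (fun s => B s v) u b ->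
  derivable_pt_lim (fun s => A' s v) u a' -> derivable_pt_lim (fun s => B' s v) u b' ->
  pdu (fun s t => A s t * B s t + A' s t * B' s t) u v =
    a * B u v + A u v * b + (a' * B' u v + A' u v * b').
Proof.
  intros. apply pdu_derivable.
  apply (derivable_pt_lim_plus (fun s => A s v * B s v) (fun s => A' s v * B' s v)).
  - now apply (derivable_pt_lim_mult (fun s => A s v) (fun s => B s v)).
  - now apply (derivable_pt_lim_mult (fun s => A' s v) (fun s => B' s v)).
Qed.

Lemma pdv_sum_prod (A B A' B' : R -> R -> R) (u v a b a' b' : R) :
  derivable_pt_lim (fun t => A u t) v a -> derivable_pt_lim (fun t => B u t) v b ->
  derivable_pt_lim (fun t => A' u t) v a' -> derivable_pt_lim (fun t => B' u t) v b' ->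
  pdv (fun s t => A s t * B s t + A' s t * B' s t) u v =
    a * B u v + A u v * b + (a' * B' u v + A' u v * b').
Proof.
  intros. apply pdv_derivable.
  apply (derivable_pt_lim_plus (fun t => A u t * B u t) (fun t => A' u t * B' u t)).
  - now apply (derivable_pt_lim_mult (fun t => A u t) (fun t => B u t)).
  - now apply (derivable_pt_lim_mult (fun t => A' u t) (fun t => B' u t)).
Qed.

(* Differentiating [E = G] and [F = 0] shows that the Laplacian of [(x, y)] is orthogonal
   to both [f_u] and [f_v], which span the plane. *)
Lemma isothermal_harmonic (U : R -> R -> Prop) (x y z : R -> R -> R) (u v : R) :
  open2 U -> smooth_on U x -> smooth_on U y -> isothermal U x y z -> U u v ->
  0 < gm x y false false u v ->
  pdu (pdu x) u v + pdv (pdv x) u v = 0 /\ pdu (pdu y) u v + pdv (pdv y) u v = 0.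
Proof.
  intros HU Hx Hy Hi Huv HE.
  assert (Mx := Ck_2_mixed U x u v HU (Hx 2%nat) Huv).
  assert (My := Ck_2_mixed U y u v HU (Hy 2%nat) Huv).
  destruct (Hx 2%nat) as (_ & _ & Hxu & Hxv). destruct (Hy 2%nat) as (_ & _ & Hyu & Hyv).
  destruct (Ck_derivable 0 U _ u v Hxu Huv) as [xuu xuv].
  destruct (Ck_derivable 0 U _ u v Hxv Huv) as [xvu xvv].
  destruct (Ck_derivable 0 U _ u v Hyu Huv) as [yuu yuv].
  destruct (Ck_derivable 0 U _ u v Hyv Huv) as [yvu yvv].
  assert (Zu : pdu (fun _ _ => 0) u v = 0)
    by (apply (pdu_derivable (fun _ _ => 0)); apply derivable_pt_lim_const).
  assert (Zv : pdv (fun _ _ => 0) u v = 0)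
    by (apply (pdv_derivable (fun _ _ => 0)); apply derivable_pt_lim_const).
  destruct (pd_ext_open U (gm x y false false) (gm x y true true) u v HU) as [E1 E2]; auto.
  { intros s t Hst; now apply Hi. }
  destruct (pd_ext_open U (gm x y false true) (fun _ _ => 0) u v HU) as [F1 F2]; auto.
  { intros s t Hst; now apply Hi. }
  rewrite Zu in F1. rewrite Zv in F2. destruct (Hi u v Huv) as [G1 G2].
  unfold gm in *; simpl D in *.
  rewrite (pdu_sum_prod _ _ _ _ u v _ _ _ _ xuu xuu yuu yuu),
    (pdu_sum_prod _ _ _ _ u v _ _ _ _ xvu xvu yvu yvu) in E1.
  rewrite (pdv_sum_prod _ _ _ _ u v _ _ _ _ xuv xuv yuv yuv),
    (pdv_sum_prod _ _ _ _ u v _ _ _ _ xvv xvv yvv yvv) in E2.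
  rewrite (pdu_sum_prod _ _ _ _ u v _ _ _ _ xuu xvu yuu yvu) in F1.
  rewrite (pdv_sum_prod _ _ _ _ u v _ _ _ _ xuv xvv yuv yvv) in F2.
  rewrite Mx, My in *. clear - E1 E2 F1 F2 G1 G2 HE.
  set (xu := pdu x u v) in *. set (xv := pdv x u v) in *.
  set (yu := pdu y u v) in *. set (yv := pdv y u v) in *.
  set (X := pdu (pdu x) u v + pdv (pdv x) u v). set (Y := pdu (pdu y) u v + pdv (pdv y) u v).
  (* [O1] combines the u-derivative of E = G with the v-derivative of F = 0; [O2] combines the
     v-derivative of E = G with the u-derivative of F = 0. *)
  assert (O1 : xu * X + yu * Y = 0) by (unfold X, Y; lra).
  assert (O2 : xv * X + yv * Y = 0) by (unfold X, Y; lra).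
  (* The Jacobian of (x, y). By Lagrange's identity J^2 = E G - F^2 = E^2, so J is nonzero and
     Cramer's rule applies. *)
  set (J := xu * yv - xv * yu).
  assert (HJ : J * J = (xu * xu + yu * yu) * (xv * xv + yv * yv)).
  { replace (J * J) with ((xu * xu + yu * yu) * (xv * xv + yv * yv)
      - (xu * xv + yu * yv) * (xu * xv + yu * yv)) by (unfold J; ring).
    rewrite G2. ring. }
  assert (NJ : J <> 0) by (intros E; rewrite E, <- G1 in HJ; nra).
  assert (JX : J * X = 0).
  { replace (J * X) with (yv * (xu * X + yu * Y) - yu * (xv * X + yv * Y))
      by (unfold J; ring). rewrite O1, O2. ring. }
  assert (JY : J * Y = 0).
  { replace (J * Y) with (xu * (xv * X + yv * Y) - xv * (xu * X + yu * Y))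
      by (unfold J; ring). rewrite O1, O2. ring. }
  split; [destruct (Rmult_integral _ _ JX) | destruct (Rmult_integral _ _ JY)]; tauto.
Qed.

(** * Potentials on simply connected domains *)


Definition box_in (U : R -> R -> Prop) (a b r : R) : Prop :=
  forall u v, box a b r u v -> U u v.

(** Additivity is asked only of three points in a common box inside [U]; for distant points [inc]
    may be arbitrary. *)
Definition cocycle (U : R -> R -> Prop) (inc : C -> C -> R) : Prop :=
  forall a b r, box_in U a b r -> forall p q m, pbox a b r p -> pbox a b r q ->
    pbox a b r m -> inc p q + inc q m = inc p m.

Definition segment_integral (P Q : R -> R -> R) (p q : C) : R :=
  RInt (fun t => P (fst p + t * (fst q - fst p)) (snd p + t * (snd q - snd p)) * (fst q - fst p)
    + Q (fst p + t * (fst q - fst p)) (snd p + t * (snd q - snd p)) * (snd q - snd p)) 0 1.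

Lemma Rabs_convex (x y a r t : R) : Rabs (x - a) < r -> Rabs (y - a) < r -> 0 <= t <= 1 ->
  Rabs (x + t * (y - x) - a) < r.
Proof.
  intros Hx Hy Ht. apply (Rabs_between_convex x y); auto.
  unfold Rmin, Rmax. destruct (Rle_dec x y); nra.
Qed.

Lemma pbox_segment (a b r : R) (p q : C) (t : R) : pbox a b r p -> pbox a b r q ->
  0 <= t <= 1 ->
  box a b r (fst p + t * (fst q - fst p)) (snd p + t * (snd q - snd p)).
Proof. intros [P1 P2] [Q1 Q2] Ht. split; now apply Rabs_convex. Qed.

Lemma derivable_pt_lim_affine (a b t : R) : derivable_pt_lim (fun s => a + s * b) t b.
Proof. apply is_derive_Reals. auto_derive; auto. ring. Qed.

Lemma segment_integral_potential (L P Q : R -> R -> R) (a b r : R) (p q : C) :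
  (forall u v, box a b r u v -> differentiable_pt_lim L u v (P u v) (Q u v)) ->
  (forall u v, box a b r u v -> cont_at P Q u v) -> pbox a b r p -> pbox a b r q ->
  segment_integral P Q p q = L (fst q) (snd q) - L (fst p) (snd p).
Proof.
  intros HL HC Hp Hq. apply (is_RInt_unique (V := R_CompleteNormedModule)).
  assert (I := path_integral_potential L P Q (fun t => fst p + t * (fst q - fst p))
    (fun t => snd p + t * (snd q - snd p)) (fun _ => fst q - fst p) (fun _ => snd q - snd p)
    0 1 Rle_0_1).
  replace (L (fst q) (snd q))
    with (L (fst p + 1 * (fst q - fst p)) (snd p + 1 * (snd q - snd p)))
    by (f_equal; ring).
  replace (L (fst p) (snd p))
    with (L (fst p + 0 * (fst q - fst p)) (snd p + 0 * (snd q - snd p)))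
    by (f_equal; ring).
  apply I. intros t Ht. assert (B := pbox_segment a b r p q t Hp Hq Ht).
  repeat split; auto using derivable_pt_lim_affine; try apply HC; auto;
    apply continuous_const.
Qed.

(** Inside a box every segment integral is a difference of values of one local potential, so the sum
    telescopes. *)
Lemma segment_integral_cocycle (U : R -> R -> Prop) (P Q : R -> R -> R) :
  (forall u v, U u v -> closed_at P Q u v) -> cocycle U (segment_integral P Q).
Proof.
  intros H a b r HU p q m Hp Hq Hm.
  destruct (local_potential P Q a b r) as [L HL]; [auto|].
  assert (HC : forall u v, box a b r u v -> cont_at P Q u v)
    by (intros; apply closed_at_cont; auto).
  rewrite !(segment_integral_potential L P Q a b r); auto. ring.
Qed.

Fixpoint chain (inc : C -> C -> R) (c : nat -> C) (n : nat) : R :=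
  match n with
  | O => 0
  | S k => chain inc c k + inc (c k) (c (S k))
  end.

Lemma chain_ext (inc : C -> C -> R) (c c' : nat -> C) (n : nat) :
  (forall i, (i <= n)%nat -> c i = c' i) -> chain inc c n = chain inc c' n.
Proof.
  induction n as [|n IH]; intros H; auto. simpl. rewrite !H by lia. now rewrite IH by auto.
Qed.

Lemma chain_split (inc : C -> C -> R) (c : nat -> C) (n m : nat) :
  chain inc c (n + m) = chain inc c n + chain inc (fun i => c (n + i)%nat) m.
Proof.
  induction m as [|m IH]; simpl.
  - rewrite Nat.add_0_r. ring.
  - rewrite Nat.add_succ_r. simpl. rewrite IH. ring.
Qed.

Lemma cocycle_refl (U : R -> R -> Prop) (inc : C -> C -> R) (a b r : R) (p : C) :
  cocycle U inc -> box_in U a b r -> pbox a b r p -> inc p p = 0.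
Proof. intros H HB Hp. assert (E := H a b r HB p p p Hp Hp Hp). lra. Qed.

Lemma cocycle_opp (U : R -> R -> Prop) (inc : C -> C -> R) (a b r : R) (p q : C) :
  cocycle U inc -> box_in U a b r -> pbox a b r p -> pbox a b r q -> inc q p = - inc p q.
Proof.
  intros H HB Hp Hq. assert (E := H a b r HB p q p Hp Hq Hp).
  rewrite (cocycle_refl U inc a b r p H HB Hp) in E. lra.
Qed.

Lemma chain_box (U : R -> R -> Prop) (inc : C -> C -> R) (a b r : R) (c : nat -> C) (n : nat) :
  cocycle U inc -> box_in U a b r -> (forall i, (i <= n)%nat -> pbox a b r (c i)) ->
  chain inc c n = inc (c 0%nat) (c n).
Proof.
  intros H HB. induction n as [|n IH]; intros Hc; simpl.
  - symmetry. apply (cocycle_refl U inc a b r); auto.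
  - rewrite IH by auto. apply (H a b r); auto; apply Hc; lia.
Qed.

(** Refining a sample does not change its sum as long as each coarse step fits in a box together
    with its subdivision points. *)
Lemma chain_blocks (U : R -> R -> Prop) (inc : C -> C -> R) (c : nat -> C) (k M : nat) :
  cocycle U inc ->
  (forall j, (j < k)%nat -> exists a b r, box_in U a b r /\
     forall i, (i <= M)%nat -> pbox a b r (c (j * M + i)%nat)) ->
  chain inc c (k * M) = chain inc (fun j => c (j * M)%nat) k.
Proof.
  intros H. induction k as [|k IH]; intros Hk; auto.
  replace (S k * M)%nat with (k * M + M)%nat by lia. rewrite chain_split, IH by auto.
  destruct (Hk k ltac:(lia)) as (a & b & r & HB & Hc).
  rewrite (chain_box U inc a b r (fun i => c (k * M + i)%nat) M) by auto.
  cbn [chain]. rewrite Nat.add_0_r.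
  replace (S k * M)%nat with (k * M + M)%nat by lia. reflexivity.
Qed.

Lemma chain_rev (U : R -> R -> Prop) (inc : C -> C -> R) (c : nat -> C) (n : nat) :
  cocycle U inc ->
  (forall i, (i < n)%nat -> exists a b r, box_in U a b r /\
     pbox a b r (c i) /\ pbox a b r (c (S i))) ->
  chain inc (fun i => c (n - i)%nat) n = - chain inc c n.
Proof.
  intros H. induction n as [|n IH]; intros Hn; [simpl; ring|].
  change (S n) with (1 + n)%nat at 2. rewrite chain_split.
  rewrite (chain_ext inc (fun i => c (S n - (1 + i))%nat) (fun i => c (n - i)%nat) n)
    by (intros; f_equal; lia).
  rewrite IH by auto. cbn [chain]. replace (S n - 0)%nat with (S n) by lia.
  replace (S n - 1)%nat with n by lia.
  destruct (Hn n ltac:(lia)) as (a & b & r & HB & H1 & H2).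
  rewrite (cocycle_opp U inc a b r (c n)); auto. ring.
Qed.

(** Both ways round a cell equal the increment along its diagonal; summing over the cells cancels
    the inner rungs. *)
Lemma chain_ladder (U : R -> R -> Prop) (inc : C -> C -> R) (c c' : nat -> C) (n : nat) :
  cocycle U inc ->
  (forall i, (i < n)%nat -> exists a b r, box_in U a b r /\
     pbox a b r (c i) /\ pbox a b r (c (S i)) /\ pbox a b r (c' i) /\ pbox a b r (c' (S i))) ->
  chain inc c n + inc (c n) (c' n) = inc (c 0%nat) (c' 0%nat) + chain inc c' n.
Proof.
  intros H. induction n as [|n IH]; intros Hn; [simpl; ring|].
  specialize (IH (fun i Hi => Hn i (Nat.lt_lt_succ_r _ _ Hi))). simpl.
  destruct (Hn n ltac:(lia)) as (a & b & r & HB & H1 & H2 & H3 & H4).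
  assert (E1 := H a b r HB (c n) (c (S n)) (c' (S n)) H1 H2 H4).
  assert (E2 := H a b r HB (c n) (c' n) (c' (S n)) H1 H3 H4). lra.
Qed.

(** [d] is a Lebesgue number for the cover of the square by preimages of boxes in [U]. *)
Lemma lebesgue_box (U : R -> R -> Prop) (H : R -> R -> Cx) : open2 U ->
  cont2_on square01 (fun s t => fst (H s t)) -> cont2_on square01 (fun s t => snd (H s t)) ->
  (forall s t, square01 s t -> U (fst (H s t)) (snd (H s t))) ->
  exists d, 0 < d /\ forall s t, square01 s t -> exists a b r, box_in U a b r /\
    forall s' t', square01 s' t' -> Rabs (s' - s) < d -> Rabs (t' - t) < d ->
      pbox a b r (H s' t').
Proof.
  intros HU H1 H2 HH.
  (* The factor 2 leaves one [e] for passing from a gauge centre to a nearby point and one for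
     moving on from there. The gauge must be total, so points outside the square receive an
     arbitrary value. *)
  assert (G : forall s t, exists e : posreal, square01 s t ->
    exists a b r, box_in U a b r /\ forall s' t', square01 s' t' ->
      Rabs (s' - s) < 2 * e -> Rabs (t' - t) < 2 * e -> pbox a b r (H s' t')).
  { intros s t. destruct (excluded_middle_informative (square01 s t)) as [S|S].
    2:{ exists (mkposreal 1 Rlt_0_1). tauto. }
    destruct (open2_box U _ _ HU (HH s t S)) as [r Hr].
    destruct (H1 s t S r (cond_pos r)) as (d1 & P1 & D1).
    destruct (H2 s t S r (cond_pos r)) as (d2 & P2 & D2).
    assert (P : 0 < Rmin d1 d2 / 4) by (assert (X := Rmin_pos d1 d2 P1 P2); lra).
    exists (mkposreal _ P). intros _. exists (fst (H s t)), (snd (H s t)), r. split.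
    - exact Hr.
    - intros s' t' S' Hs Ht. simpl in Hs, Ht.
      assert (M1 := Rmin_l d1 d2). assert (M2 := Rmin_r d1 d2).
      apply sqr_lt_of_abs in Hs. apply sqr_lt_of_abs in Ht.
      set (m := Rmin d1 d2) in *.
      assert (Hm : (s' - s) ^ 2 + (t' - t) ^ 2 < m ^ 2) by nra.
      assert (m ^ 2 <= d1 ^ 2) by (apply pow_incr; lra).
      assert (m ^ 2 <= d2 ^ 2) by (apply pow_incr; lra).
      split; [apply D1 | apply D2]; auto; lra. }
  set (delta := fun s t => proj1_sig (constructive_indefinite_description _ (G s t))).
  assert (Hdelta := fun s t => proj2_sig (constructive_indefinite_description _ (G s t))).
  destruct (compactness_value_2d 0 1 0 1 delta) as [d Hd].
  exists d. split; [apply cond_pos|]. intros s t [Hs Ht].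
  (* The compactness statement provides its gauge centre only under a double negation. *)
  apply NNPP. intros N. apply (Hd s t Hs Ht). intros (u & v & Hu & Hv & Du & Dv & Dd).
  apply N. destruct (Hdelta u v (conj Hu Hv)) as (a & b & r & HB & HP).
  exists a, b, r. split; auto. intros s' t' S' Hs' Ht'. apply HP; auto.
  - fold (delta u v). replace (s' - u) with ((s' - s) + (s - u)) by ring.
    eapply Rle_lt_trans; [apply Rabs_triang|]. lra.
  - fold (delta u v). replace (t' - v) with ((t' - t) + (t - v)) by ring.
    eapply Rle_lt_trans; [apply Rabs_triang|]. lra.
Qed.

Lemma lebesgue_path (U : R -> R -> Prop) (g : R -> Cx) : open2 U -> path_in U g ->
  exists d, 0 < d /\ forall s, 0 <= s <= 1 -> exists a b r, box_in U a b r /\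
    forall s', 0 <= s' <= 1 -> Rabs (s' - s) < d -> pbox a b r (g s').
Proof.
  intros HU (C1 & C2 & HI).
  assert (CC : forall f, cont_on01 f -> cont2_on square01 (fun s _ : R => f s)).
  { intros f Hf s t [Hs Ht] eps Heps. destruct (Hf s Hs eps Heps) as (d & Hd & Hk).
    exists d. split; auto. intros s' t' [Hs' Ht'] Hd'. apply Hk; auto.
    apply Rlt_of_sqr; [lra|]. rewrite pow2_abs. assert (X := pow2_ge_0 (t' - t)). lra. }
  destruct (lebesgue_box U (fun s _ => g s) HU (CC _ C1) (CC _ C2)) as (d & Hd & HL).
  { intros s t [Hs _]. auto. }
  exists d. split; auto. intros s Hs.
  destruct (HL s 0) as (a & b & r & HB & HP); [split; lra|].
  exists a, b, r. split; auto. intros s' Hs' Hd'. apply (HP s' 0); auto.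
  - split; lra.
  - rewrite Rminus_diag, Rabs_R0. exact Hd.
Qed.

Definition sample (g : R -> Cx) (N i : nat) : C := g (INR i / INR N).

Lemma INR_ratio_bounds (i N : nat) : (i <= N)%nat -> (0 < N)%nat -> 0 <= INR i / INR N <= 1.
Proof.
  intros Hi HN. assert (P := lt_0_INR N HN). apply le_INR in Hi. assert (Q := pos_INR i).
  split; [apply Rdiv_le_0_compat; lra|]. apply (Rdiv_le_1 (INR i) (INR N)); lra.
Qed.

Lemma large_N (d : R) : 0 < d ->
  exists N0, (0 < N0)%nat /\ forall N, (N0 <= N)%nat -> / INR N < d.
Proof.
  intros Hd. destruct (archimed_cor1 d Hd) as (N0 & H1 & H2). exists N0. split; auto.
  intros N HN. eapply Rle_lt_trans; [|exact H1]. apply Rinv_le_contravar.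
  - now apply lt_0_INR.
  - now apply le_INR.
Qed.

Lemma INR_ratio_step (i N : nat) : (0 < N)%nat ->
  INR (S i) / INR N - INR i / INR N = / INR N.
Proof. intros HN. assert (P := lt_0_INR N HN). rewrite S_INR. field. lra. Qed.

(** The integral of a cocycle along a path that need not be differentiable: the sums have to become
    constant, not merely to converge. *)
Definition eventual (inc : C -> C -> R) (g : R -> Cx) (e : R) : Prop :=
  exists N0, forall N, (N0 <= N)%nat -> chain inc (sample g N) N = e.

Lemma eventual_unique (inc : C -> C -> R) (g : R -> Cx) (e e' : R) :
  eventual inc g e -> eventual inc g e' -> e = e'.
Proof.
  intros [N H] [N' H']. rewrite <- (H (N + N')%nat), <- (H' (N + N')%nat); auto; lia.
Qed.

Lemma eventual_exists (U : R -> R -> Prop) (inc : C -> C -> R) (g : R -> Cx) :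
  open2 U -> cocycle U inc -> path_in U g -> exists e, eventual inc g e.
Proof.
  intros HU Hi Hg. destruct (lebesgue_path U g HU Hg) as (d & Hd & HL).
  destruct (large_N d Hd) as (N0 & P0 & HN0).
  assert (R0 : forall N M, (N0 <= N)%nat -> (0 < M)%nat ->
    chain inc (sample g (N * M)) (N * M) = chain inc (sample g N) N).
  { intros N M HN HM. assert (PN : (0 < N)%nat) by lia.
    assert (IN := lt_0_INR N PN). assert (IM := lt_0_INR M HM).
    rewrite (chain_blocks U).
    - apply chain_ext. intros i _. unfold sample. f_equal. rewrite !mult_INR. field. lra.
    - exact Hi.
    - intros j Hj. destruct (HL (INR j / INR N)) as (a & b & r & HB & HP).
      { apply INR_ratio_bounds; lia. }
      exists a, b, r. split; auto. intros i HiM. apply HP.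
      + apply INR_ratio_bounds; nia.
      + rewrite plus_INR, !mult_INR.
        replace ((INR j * INR M + INR i) / (INR N * INR M) - INR j / INR N)
          with (INR i / INR M * / INR N) by (field; lra).
        assert (B := INR_ratio_bounds i M HiM HM). assert (X := HN0 N HN).
        assert (Y := Rinv_0_lt_compat _ IN).
        rewrite Rabs_right by nra. nra. }
  exists (chain inc (sample g N0) N0). exists N0. intros N HN.
  (* Neither of [N] and [N0] need divide the other; both are compared with their product. *)
  rewrite <- (R0 N N0), <- (R0 N0 N) by lia. now rewrite Nat.mul_comm.
Qed.

(** The homotopy is free: the base point may move along [H 0 t], but the first and last rungs
    between two rows coincide and cancel. The final row is constant and contributes 0. *)
Lemma eventual_null_homotopic (U : R -> R -> Prop) (inc : C -> C -> R) (g : R -> Cx)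
  (H : R -> R -> Cx) (p : Cx) : open2 U -> cocycle U inc ->
  cont2_on square01 (fun s t => fst (H s t)) -> cont2_on square01 (fun s t => snd (H s t)) ->
  (forall s t, square01 s t -> U (fst (H s t)) (snd (H s t))) ->
  (forall s, 0 <= s <= 1 -> H s 0 = g s) -> (forall s, 0 <= s <= 1 -> H s 1 = p) ->
  (forall t, 0 <= t <= 1 -> H 0 t = H 1 t) -> eventual inc g 0.
Proof.
  intros HU Hi H1 H2 HH Hg Hp Hl.
  destruct (lebesgue_box U H HU H1 H2 HH) as (d & Hd & HL).
  destruct (large_N d Hd) as (N0 & P0 & HN0). exists N0. intros N HN.
  assert (PN : (0 < N)%nat) by lia. assert (IN := lt_0_INR N PN).
  assert (iN := HN0 N HN). assert (iP := Rinv_0_lt_compat _ IN).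
  set (c := fun j i : nat => H (INR i / INR N) (INR j / INR N)).
  assert (E0 : INR 0 / INR N = 0) by (simpl; field; lra).
  assert (EN : INR N / INR N = 1) by (field; lra).
  assert (Step : forall j, (j < N)%nat -> chain inc (c j) N = chain inc (c (S j)) N).
  { intros j Hj.
    assert (L := chain_ladder U inc (c j) (c (S j)) N Hi).
    assert (Ends : forall j, (j <= N)%nat -> c j 0%nat = c j N).
    { intros k Hk. unfold c. rewrite E0, EN. apply Hl. apply INR_ratio_bounds; lia. }
    rewrite (Ends j), (Ends (S j)) in L by lia.
    enough (chain inc (c j) N + inc (c j N) (c (S j) N)
            = inc (c j N) (c (S j) N) + chain inc (c (S j)) N) by lra.
    (* All four corners of a cell differ from its lower left one by at most 1 / N < d in each
       parameter, so a single box holds them. *)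
    apply L; auto. intros i HiN.
    destruct (HL (INR i / INR N) (INR j / INR N)) as (a & b & r & HB & HP).
    { split; apply INR_ratio_bounds; lia. }
    exists a, b, r. split; auto. unfold c.
    assert (Z : Rabs 0 < d) by (rewrite Rabs_R0; lra).
    assert (Y : Rabs (/ INR N) < d) by (rewrite Rabs_right; lra).
    repeat split; apply HP; try (split; apply INR_ratio_bounds; lia);
      rewrite ?INR_ratio_step, ?Rminus_diag; auto. }
  assert (All : forall j, (j <= N)%nat -> chain inc (c 0%nat) N = chain inc (c j) N).
  { induction j as [|j IH]; intros Hj; auto. rewrite IH by lia. apply Step. lia. }
  rewrite (chain_ext inc _ (c 0%nat)).
  - rewrite (All N) by lia.
    rewrite (chain_ext inc _ (fun _ => p)).
    + destruct (HL 0 1) as (a & b & r & HB & HP); [split; lra|].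
      rewrite (chain_box U inc a b r); auto.
      * apply (cocycle_refl U inc a b r); auto. rewrite <- (Hp 0) by lra.
        apply HP; [split; lra | |]; rewrite Rminus_diag, Rabs_R0; auto.
      * intros i _. rewrite <- (Hp 0) by lra.
        apply HP; [split; lra | |]; rewrite Rminus_diag, Rabs_R0; auto.
    + intros i HiN. unfold c. rewrite EN. apply Hp. now apply INR_ratio_bounds.
  - intros i HiN. unfold sample, c. rewrite E0. symmetry. apply Hg. now apply INR_ratio_bounds.
Qed.

Definition path_cat (g h : R -> Cx) (s : R) : Cx :=
  if Rle_dec s (/ 2) then g (2 * s) else h (2 * s - 1).

Lemma cont_on01_cat (f g : R -> R) : cont_on01 f -> cont_on01 g -> f 1 = g 0 ->
  cont_on01 (fun s => if Rle_dec s (/ 2) then f (2 * s) else g (2 * s - 1)).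
Proof.
  intros Hf Hg E t Ht eps Heps.
  destruct (Rle_dec t (/ 2)) as [T|T].
  - destruct (Hf (2 * t) ltac:(lra) eps Heps) as (d & Hd & Hk).
    destruct (Req_dec t (/ 2)) as [T'|T'].
    + destruct (Hg 0 ltac:(lra) eps Heps) as (d' & Hd' & Hk').
      exists (Rmin d d' / 2). assert (M := Rmin_pos d d' Hd Hd').
      assert (M1 := Rmin_l d d'). assert (M2 := Rmin_r d d'). split; [lra|].
      intros s Hs Hst. apply Rabs_def2 in Hst. destruct (Rle_dec s (/ 2)) as [S|S].
      * apply Hk; [lra|]. apply Rabs_def1; lra.
      * replace (2 * t) with 1 by lra. rewrite E. apply Hk'; [lra|]. apply Rabs_def1; lra.
    + exists (Rmin (d / 2) (/ 2 - t)).
      assert (M := Rmin_pos (d / 2) (/ 2 - t) ltac:(lra) ltac:(lra)).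
      assert (M1 := Rmin_l (d / 2) (/ 2 - t)). assert (M2 := Rmin_r (d / 2) (/ 2 - t)).
      split; auto. intros s Hs Hst. apply Rabs_def2 in Hst.
      destruct (Rle_dec s (/ 2)) as [S|S]; [|lra]. apply Hk; [lra|]. apply Rabs_def1; lra.
  - destruct (Hg (2 * t - 1) ltac:(lra) eps Heps) as (d & Hd & Hk).
    exists (Rmin (d / 2) (t - / 2)).
    assert (M := Rmin_pos (d / 2) (t - / 2) ltac:(lra) ltac:(lra)).
    assert (M1 := Rmin_l (d / 2) (t - / 2)). assert (M2 := Rmin_r (d / 2) (t - / 2)).
    split; auto. intros s Hs Hst. apply Rabs_def2 in Hst.
    destruct (Rle_dec s (/ 2)) as [S|S]; [lra|]. apply Hk; [lra|]. apply Rabs_def1; lra.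
Qed.

Lemma cont_on01_ext (f g : R -> R) : (forall t, f t = g t) -> cont_on01 f -> cont_on01 g.
Proof.
  intros E H t Ht eps Heps. destruct (H t Ht eps Heps) as (d & Hd & Hk).
  exists d. split; auto. intros s Hs Hst. rewrite <- !E. auto.
Qed.

Lemma path_in_cat (U : R -> R -> Prop) (g h : R -> Cx) :
  path_in U g -> path_in U h -> g 1 = h 0 -> path_in U (path_cat g h).
Proof.
  intros (G1 & G2 & GU) (H1 & H2 & HU) E. split; [|split].
  - apply (cont_on01_ext
      (fun s => if Rle_dec s (/ 2) then fst (g (2 * s)) else fst (h (2 * s - 1)))).
    + intros t. unfold path_cat. now destruct (Rle_dec t (/ 2)).
    + apply (cont_on01_cat (fun s => fst (g s)) (fun s => fst (h s))); auto. now rewrite E.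
  - apply (cont_on01_ext
      (fun s => if Rle_dec s (/ 2) then snd (g (2 * s)) else snd (h (2 * s - 1)))).
    + intros t. unfold path_cat. now destruct (Rle_dec t (/ 2)).
    + apply (cont_on01_cat (fun s => snd (g s)) (fun s => snd (h s))); auto. now rewrite E.
  - intros t Ht. unfold path_cat. destruct (Rle_dec t (/ 2)); [apply GU | apply HU]; lra.
Qed.

Lemma path_in_rev (U : R -> R -> Prop) (g : R -> Cx) :
  path_in U g -> path_in U (fun s => g (1 - s)).
Proof.
  intros (G1 & G2 & GU).
  assert (CR : forall f, cont_on01 f -> cont_on01 (fun s => f (1 - s))).
  { intros f Hf t Ht eps Heps. destruct (Hf (1 - t) ltac:(lra) eps Heps) as (d & Hd & Hk).
    exists d. split; auto. intros s Hs Hst. apply Hk; [lra|].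
    rewrite <- Rabs_Ropp. now replace (- (1 - s - (1 - t))) with (s - t) by ring. }
  split; [|split].
  - exact (CR _ G1).
  - exact (CR _ G2).
  - intros t Ht. apply GU. lra.
Qed.

(** An even number of steps puts a sample exactly on the seam. That sample is computed by the first
    branch, and g 1 = h 0 identifies it with the start of [h]. *)
Lemma sample_cat (g h : R -> Cx) (N i : nat) : (0 < N)%nat -> (i <= N)%nat -> g 1 = h 0 ->
  sample (path_cat g h) (N + N) i = sample g N i /\
  sample (path_cat g h) (N + N) (N + i) = sample h N i.
Proof.
  intros PN Hi E. assert (IN := lt_0_INR N PN). assert (B := INR_ratio_bounds i N Hi PN).
  unfold sample, path_cat. rewrite !plus_INR.
  replace (INR i / (INR N + INR N)) with (/ 2 * (INR i / INR N)) by (field; lra).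
  replace ((INR N + INR i) / (INR N + INR N)) with (/ 2 + / 2 * (INR i / INR N)) by (field; lra).
  set (x := INR i / INR N) in *. split.
  - destruct (Rle_dec (/ 2 * x) (/ 2)); [|lra]. f_equal. field.
  - destruct (Rle_dec (/ 2 + / 2 * x) (/ 2)).
    + replace x with 0 by lra. replace (2 * (/ 2 + / 2 * 0)) with 1 by field. exact E.
    + f_equal. field.
Qed.

(** The concatenation has some eventual value by [eventual_exists], so it may be computed along even
    sample counts alone. *)
Lemma eventual_cat (U : R -> R -> Prop) (inc : C -> C -> R) (g h : R -> Cx) (e f : R) :
  open2 U -> cocycle U inc -> path_in U g -> path_in U h -> g 1 = h 0 ->
  eventual inc g e -> eventual inc h f -> eventual inc (path_cat g h) (e + f).
Proof.
  intros HU Hi Hg Hh E [N1 H1] [N2 H2].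
  destruct (eventual_exists U inc (path_cat g h) HU Hi (path_in_cat U g h Hg Hh E)) as [x Hx].
  replace (e + f) with x; auto. destruct Hx as [N3 H3].
  set (N := (N1 + N2 + N3 + 1)%nat).
  rewrite <- (H1 N), <- (H2 N), <- (H3 (N + N)%nat) by (unfold N; lia).
  rewrite chain_split. f_equal; apply chain_ext; intros i HiN;
    apply sample_cat; auto; unfold N; lia.
Qed.

Lemma eventual_rev (U : R -> R -> Prop) (inc : C -> C -> R) (g : R -> Cx) (e : R) :
  open2 U -> cocycle U inc -> path_in U g -> eventual inc g e ->
  eventual inc (fun s => g (1 - s)) (- e).
Proof.
  intros HU Hi Hg [N1 H1]. destruct (lebesgue_path U g HU Hg) as (d & Hd & HL).
  destruct (large_N d Hd) as (N0 & P0 & HN0). exists (N0 + N1)%nat. intros N HN.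
  assert (PN : (0 < N)%nat) by lia. assert (IN := lt_0_INR N PN).
  assert (iN := HN0 N ltac:(lia)). assert (iP := Rinv_0_lt_compat _ IN).
  rewrite <- (H1 N) by lia. rewrite <- (chain_rev U); auto.
  - apply chain_ext. intros i HiN. unfold sample. f_equal. rewrite minus_INR by auto. field. lra.
  - intros i HiN. destruct (HL (INR i / INR N)) as (a & b & r & HB & HP).
    { apply INR_ratio_bounds; lia. }
    exists a, b, r. split; auto.
    split; apply HP; try (apply INR_ratio_bounds; lia);
      rewrite ?INR_ratio_step, ?Rminus_diag by auto.
    + rewrite Rabs_R0. lra.
    + rewrite Rabs_right; lra.
Qed.

(** [g] followed by the reversed [h] is a loop with eventual value e - f, and null homotopy makes
    this zero. *)
Lemma eventual_same_ends (U : R -> R -> Prop) (inc : C -> C -> R) (g h : R -> Cx) (e f : R) :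
  simply_connected_domain U -> cocycle U inc -> path_in U g -> path_in U h ->
  g 0 = h 0 -> g 1 = h 1 -> eventual inc g e -> eventual inc h f -> e = f.
Proof.
  intros (HU & _ & _ & HS) Hi Hg Hh E0 E1 He Hf.
  assert (Hr := path_in_rev U h Hh).
  assert (Er : g 1 = h (1 - 0)) by (rewrite E1; f_equal; ring).
  assert (L := eventual_cat U inc g (fun s => h (1 - s)) e (- f) HU Hi Hg Hr Er He
                 (eventual_rev U inc h f HU Hi Hh Hf)).
  destruct (HS (path_cat g (fun s => h (1 - s)))) as (H & H1 & H2 & H3 & H4 & [p Hp] & H5).
  - now apply path_in_cat.
  - unfold path_cat. destruct (Rle_dec 0 (/ 2)); [|lra]. destruct (Rle_dec 1 (/ 2)); [lra|].
    replace (2 * 0) with 0 by ring. replace (1 - (2 * 1 - 1)) with 0 by ring. exact E0.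
  - assert (Z := eventual_null_homotopic U inc _ H p HU Hi H1 H2 H3 H4 Hp H5).
    assert (X := eventual_unique _ _ _ _ L Z). lra.
Qed.

Definition segment (p q : C) (t : R) : Cx :=
  (fst p + t * (fst q - fst p), snd p + t * (snd q - snd p)).

Lemma path_in_segment (U : R -> R -> Prop) (a b r : R) (p q : C) :
  box_in U a b r -> pbox a b r p -> pbox a b r q -> path_in U (segment p q).
Proof.
  intros HB Hp Hq.
  assert (CA : forall x y, cont_on01 (fun t => x + t * y)).
  { intros x y t _ eps Heps.
    assert (P : 0 < Rabs y + 1) by (assert (X := Rabs_pos y); lra).
    exists (eps / (Rabs y + 1)). split; [now apply Rdiv_lt_0_compat|].
    intros s _ Hs. replace (x + s * y - (x + t * y)) with ((s - t) * y) by ring.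
    rewrite Rabs_mult. apply (Rlt_div_r (Rabs (s - t)) eps (Rabs y + 1)) in Hs; auto.
    assert (X := Rabs_pos (s - t)). assert (Y := Rabs_pos y). nra. }
  split; [|split].
  - apply CA.
  - apply CA.
  - intros t Ht. apply HB. now apply pbox_segment.
Qed.

Lemma eventual_segment (U : R -> R -> Prop) (inc : C -> C -> R) (a b r : R) (p q : C) :
  cocycle U inc -> box_in U a b r -> pbox a b r p -> pbox a b r q ->
  eventual inc (segment p q) (inc p q).
Proof.
  intros Hi HB Hp Hq. exists 1%nat. intros N HN. assert (IN := lt_0_INR N HN).
  rewrite (chain_box U inc a b r); auto.
  - unfold sample. f_equal; unfold segment.
    + replace (INR 0 / INR N) with 0 by (simpl; field; lra). destruct p; simpl; f_equal; ring.
    + replace (INR N / INR N) with 1 by (field; lra). destruct q; simpl; f_equal; ring.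
  - intros i HiN. apply pbox_segment; auto. now apply INR_ratio_bounds.
Qed.

Lemma pbox_center (a b r : R) : 0 < r -> pbox a b r (a, b).
Proof. intros Hr. split; simpl; now rewrite Rminus_diag, Rabs_R0. Qed.

Lemma global_potential (U : R -> R -> Prop) (P Q : R -> R -> R) (u0 v0 : R) :
  simply_connected_domain U -> (forall u v, U u v -> closed_at P Q u v) -> U u0 v0 ->
  exists L : R -> R -> R, L u0 v0 = 0 /\
    forall u v, U u v -> differentiable_pt_lim L u v (P u v) (Q u v).
Proof.
  intros HS Hc H0. assert (HS' := HS). destruct HS' as (HU & _ & HP & _).
  set (inc := segment_integral P Q).
  assert (Hi : cocycle U inc) by now apply segment_integral_cocycle.
  (* [e] is the value along some continuous path from the base point. Path connectedness gives
     existence, simple connectivity uniqueness, and [L] selects the value. *)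
  set (good := fun u v e => exists g, path_in U g /\ g 0 = (u0, v0) /\ g 1 = (u, v) /\
                              eventual inc g e).
  assert (Ex : forall u v, U u v -> exists e, good u v e).
  { intros u v Huv. destruct (HP (u0, v0) (u, v) H0 Huv) as (g & Hg & G0 & G1).
    destruct (eventual_exists U inc g HU Hi Hg) as [e He]. exists e, g. auto. }
  assert (Un : forall u v e f, good u v e -> good u v f -> e = f).
  { intros u v e f (g & Hg & G0 & G1 & He) (h & Hh & F0 & F1 & Hf).
    apply (eventual_same_ends U inc g h); auto; congruence. }
  set (L := fun u v => epsilon (inhabits 0) (good u v)).
  assert (HL : forall u v, U u v -> good u v (L u v)).
  { intros u v Huv. apply epsilon_spec. auto. }
  (* A path to (u, v) followed by a short segment is an admissible path to (u', v'). *)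
  assert (Inc : forall u v r u' v', 0 < r -> box_in U u v r -> box u v r u' v' ->
     L u' v' = L u v + inc (u, v) (u', v')).
  { intros u v r u' v' Hr HB Hb. assert (Bc := pbox_center u v r Hr).
    assert (Bq : pbox u v r (u', v')) by exact Hb.
    apply (Un u' v'); [apply HL; now apply HB|].
    destruct (HL u v (HB u v Bc)) as (g & Hg & G0 & G1 & He).
    assert (Hseg := path_in_segment U u v r (u, v) (u', v') HB Bc Bq).
    assert (J : g 1 = segment (u, v) (u', v') 0)
      by (rewrite G1; unfold segment; simpl; f_equal; ring).
    exists (path_cat g (segment (u, v) (u', v'))). split; [|split; [|split]].
    - now apply path_in_cat.
    - unfold path_cat. destruct (Rle_dec 0 (/ 2)); [|lra]. now rewrite Rmult_0_r.
    - unfold path_cat. destruct (Rle_dec 1 (/ 2)); [lra|]. unfold segment; simpl.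
      f_equal; ring.
    - apply (eventual_cat U); auto. now apply (eventual_segment U inc u v r). }
  exists L. split.
  - destruct (open2_box U u0 v0 HU H0) as [r Hr]. assert (Pr := cond_pos r).
    assert (E := Inc u0 v0 r u0 v0 Pr Hr (pbox_center u0 v0 r Pr)).
    assert (Bc := pbox_center u0 v0 r Pr).
    apply (Un u0 v0); [now apply HL|].
    exists (segment (u0, v0) (u0, v0)).
    rewrite <- (cocycle_refl U inc u0 v0 r (u0, v0) Hi Hr Bc).
    split; [|split; [|split]].
    + now apply (path_in_segment U u0 v0 r).
    + unfold segment; simpl; f_equal; ring.
    + unfold segment; simpl; f_equal; ring.
    + now apply (eventual_segment U inc u0 v0 r).
  (* On a small box [L] differs from a local potential [K] by a constant and inherits its
     differential. *)
  - intros u v Huv. destruct (open2_box U u v HU Huv) as [r Hr]. assert (Pr := cond_pos r).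
    destruct (local_potential P Q u v r) as [K HK]; [auto|].
    assert (HC : forall s t, box u v r s t -> cont_at P Q s t)
      by (intros; apply closed_at_cont; auto).
    assert (Bc := pbox_center u v r Pr).
    intros eps. destruct (HK u v Bc eps) as [d Hd].
    assert (Pm : 0 < Rmin d r) by (apply Rmin_pos; auto; apply cond_pos).
    exists (mkposreal _ Pm). simpl. intros s t Hs Ht.
    assert (M1 := Rmin_l d r). assert (M2 := Rmin_r d r).
    assert (Bs : box u v r s t) by (split; lra).
    rewrite (Inc u v r s t Pr Hr Bs). unfold inc.
    rewrite (segment_integral_potential K P Q u v r (u, v) (s, t) HK HC Bc Bs). simpl.
    replace (L u v + (K s t - K u v) - L u v) with (K s t - K u v) by ring.
    apply Hd; lra.
Qed.

(** * The representation theorem *)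


Lemma holomorphic_global_potential (U : R -> R -> Prop) (phi : R -> R -> Cx) (u0 v0 : R) :
  simply_connected_domain U -> holomorphic U phi -> U u0 v0 ->
  exists L, L u0 v0 = 0 /\ is_potential U L phi.
Proof.
  intros HS H H0.
  apply (global_potential U (fun s t => fst (phi s t)) (fun s t => - snd (phi s t))); auto.
  intros u v Huv. rewrite holomorphic_cderiv in H. destruct (H u v Huv) as [c Hc].
  now apply cderiv_closed in Hc.
Qed.

(** Makes the integral of the theorem well defined, since only the ends of the path enter the
    value. *)
Lemma potential_path_integral (U : R -> R -> Prop) (L : R -> R -> R) (phi : R -> R -> Cx)
  (g1 g2 g1' g2' : R -> R) :
  holomorphic U phi -> is_potential U L phi -> C1path U g1 g2 g1' g2' ->
  re_path_integral_is phi g1 g2 g1' g2' (L (g1 1) (g2 1) - L (g1 0) (g2 0)).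
Proof.
  intros H HL (D1 & D2 & C1 & C2 & HI).
  assert (I : RInt.is_RInt (fun t => fst (Cmul (phi (g1 t) (g2 t)) (g1' t, g2' t))) 0 1
                (L (g1 1) (g2 1) - L (g1 0) (g2 0))).
  { eapply (is_RInt_ext (V := R_NormedModule)).
    2:{ apply (path_integral_potential L (fun s t => fst (phi s t)) (fun s t => - snd (phi s t))
          g1 g2 g1' g2' 0 1 Rle_0_1).
        intros t Ht. specialize (HI t Ht). rewrite holomorphic_cderiv in H.
        destruct (H _ _ HI) as [c Hc]. apply cderiv_continuity in Hc. destruct Hc as [K1 K2].
        split; [now apply HL|]. split; [split|].
        - exact K1.
        - apply continuity_2d_pt_opp. exact K2.
        - repeat split; auto; apply continuity_pt_filterlim; auto. }
    intros t _. unfold Cmul; simpl. ring. }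
  (* The integral computed so far is converted into one with the integrability witness that
     [re_path_integral_is] requires. *)
  exists (ex_RInt_Reals_0 _ _ _ (ex_intro _ _ I)).
  rewrite <- RInt_Reals. now apply (is_RInt_unique (V := R_CompleteNormedModule)).
Qed.

(** The sum of the squares has real part g_11 - g_22 and imaginary part -2 g_12. *)
Lemma phi_of_conditions (x y : R -> R -> R) (u v : R) :
  Cadd (Cmul (phi_of x u v) (phi_of x u v)) (Cmul (phi_of y u v) (phi_of y u v)) = (0, 0) <->
  gm x y false false u v = gm x y true true u v /\ gm x y false true u v = 0.
Proof.
  unfold Cadd, Cmul, phi_of, gm; simpl. split.
  - intros E. injection E as E1 E2. split; lra.
  - intros [E1 E2]. f_equal; lra.
Qed.

Lemma phi_of_norm (x y : R -> R -> R) (u v : R) :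
  Cnorm2 (phi_of x u v) + Cnorm2 (phi_of y u v) =
  gm x y false false u v + gm x y true true u v.
Proof. unfold Cnorm2, phi_of, gm; simpl. ring. Qed.

(** The metric is E (a^2 + b^2). A vector killed by dx and dy has length zero, so positivity also
    yields injectivity of df. *)
Lemma isothermal_nondegenerate (U : R -> R -> Prop) (x y z : R -> R -> R) :
  smooth_on U x -> smooth_on U y -> smooth_on U z -> isothermal U x y z ->
  (forall u v, U u v -> 0 < gm x y false false u v) -> nondegenerate_immersion U x y z.
Proof.
  intros Hx Hy Hz Hi HE.
  assert (Pos : forall u v, U u v -> forall a b, (a, b) <> (0, 0) ->
    0 < a ^ 2 * gm x y false false u v + 2 * a * b * gm x y false true u v
        + b ^ 2 * gm x y true true u v).
  { intros u v Huv a b N. destruct (Hi u v Huv) as [E1 E2]. rewrite <- E1, E2.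
    specialize (HE u v Huv).
    assert (P : 0 < a ^ 2 + b ^ 2).
    { assert (A := pow2_ge_0 a). assert (B := pow2_ge_0 b).
      destruct (Req_dec a 0) as [->|Na].
      - destruct (Req_dec b 0) as [->|Nb]; [now elim N|]. assert (C := pow2_gt_0 b Nb). lra.
      - assert (C := pow2_gt_0 a Na). lra. }
    nra. }
  split; auto. repeat split; auto; apply NNPP; intros N;
    (assert (N' : (a, b) <> (0, 0)) by (intros E; inversion E; lra));
    assert (P := Pos u v H a b N'); unfold gm in P;
    replace (_ + _ + _) with
      ((a * D false x u v + b * D true x u v) ^ 2 + (a * D false y u v + b * D true y u v) ^ 2)
      in P by ring; rewrite H0, H1 in P; lra.
Qed.

Theorem theorem4p2p1 :
  (forall (U : R -> R -> Prop) (x y z : R -> R -> R),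
     open2 U -> nondegenerate_immersion U x y z -> d_minimal U x y z ->
     isothermal U x y z ->
     holomorphic U (phi_of x) /\ holomorphic U (phi_of y) /\
     holomorphic U (phi_of z) /\
     (forall u v, U u v ->
        0 < Cnorm2 (phi_of x u v) + Cnorm2 (phi_of y u v) /\
        Cadd (Cmul (phi_of x u v) (phi_of x u v))
             (Cmul (phi_of y u v) (phi_of y u v)) = (0, 0) /\
        gm x y false false u v = / 2 * (Cnorm2 (phi_of x u v) + Cnorm2 (phi_of y u v)) /\
        gm x y true true u v = / 2 * (Cnorm2 (phi_of x u v) + Cnorm2 (phi_of y u v))))
  /\
  (forall (U : R -> R -> Prop) (phi1 phi2 phi3 : R -> R -> Cx) (u0 v0 : R),
     simply_connected_domain U ->
     holomorphic U phi1 -> holomorphic U phi2 -> holomorphic U phi3 ->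
     (forall u v, U u v ->
        0 < Cnorm2 (phi1 u v) + Cnorm2 (phi2 u v) /\
        Cadd (Cmul (phi1 u v) (phi1 u v)) (Cmul (phi2 u v) (phi2 u v)) = (0, 0)) ->
     U u0 v0 ->
     exists x y z : R -> R -> R,
       (forall u v, U u v ->
          forall g1 g2 g1' g2', C1path U g1 g2 g1' g2' ->
            g1 0 = u0 -> g2 0 = v0 -> g1 1 = u -> g2 1 = v ->
            re_path_integral_is phi1 g1 g2 g1' g2' (x u v) /\
            re_path_integral_is phi2 g1 g2 g1' g2' (y u v) /\
            re_path_integral_is phi3 g1 g2 g1' g2' (z u v)) /\
       nondegenerate_immersion U x y z /\ d_minimal U x y z /\
       (forall u v, U u v ->
          phi1 u v = phi_of x u v /\ phi2 u v = phi_of y u v /\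
          phi3 u v = phi_of z u v) /\
       isothermal U x y z).
Proof.
  split.
  - intros U x y z HU [(Hx & Hy & Hz & _) Hn] Hm Hi.
    assert (HE : forall u v, U u v -> 0 < gm x y false false u v).
    (* Testing the metric on the vector (1, 0) isolates g_11. *)
    { intros u v Huv. assert (P := Hn u v Huv 1 0 ltac:(intros E; inversion E; lra)). lra. }
    assert (Hh := fun u v Huv => isothermal_harmonic U x y z u v HU Hx Hy Hi Huv (HE u v Huv)).
    split; [|split; [|split]].
    + apply harmonic_holomorphic; auto. intros u v Huv. now apply Hh.
    + apply harmonic_holomorphic; auto. intros u v Huv. now apply Hh.
    + apply harmonic_holomorphic; auto. intros u v Huv.
      assert (T := Hm u v Huv). specialize (HE u v Huv).
      rewrite (trace_h_isothermal U) in T by auto.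
      apply Rmult_integral in T. destruct T as [T|T]; auto.
      apply Rinv_0_lt_compat in HE. lra.
    + intros u v Huv. specialize (HE u v Huv). rewrite phi_of_norm, phi_of_conditions.
      destruct (Hi u v Huv) as [E1 E2]. repeat split; lra.
  - intros U phi1 phi2 phi3 u0 v0 HS H1 H2 H3 Hphi H0.
    destruct (holomorphic_global_potential U phi1 u0 v0 HS H1 H0) as (x & X0 & Hx).
    destruct (holomorphic_global_potential U phi2 u0 v0 HS H2 H0) as (y & Y0 & Hy).
    destruct (holomorphic_global_potential U phi3 u0 v0 HS H3 H0) as (z & Z0 & Hz).
    assert (HU : open2 U) by apply HS.
    assert (Hi : isothermal U x y z).
    { intros u v Huv. apply phi_of_conditions.
      rewrite <- (potential_phi_of U x phi1), <- (potential_phi_of U y phi2) by auto.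
      now apply Hphi. }
    assert (HE : forall u v, U u v -> 0 < gm x y false false u v).
    { intros u v Huv. destruct (Hphi u v Huv) as [P _]. destruct (Hi u v Huv) as [E _].
      rewrite (potential_phi_of U x phi1), (potential_phi_of U y phi2), phi_of_norm in P by auto.
      lra. }
    exists x, y, z. split; [|split; [|split; [|split]]]; auto.
    + intros u v Huv g1 g2 g1' g2' Hg <- <- <- <-.
      (* The potentials vanish at the base point, so their increments are the values themselves. *)
      replace (x (g1 1) (g2 1)) with (x (g1 1) (g2 1) - x (g1 0) (g2 0)) by lra.
      replace (y (g1 1) (g2 1)) with (y (g1 1) (g2 1) - y (g1 0) (g2 0)) by lra.
      replace (z (g1 1) (g2 1)) with (z (g1 1) (g2 1) - z (g1 0) (g2 0)) by lra.
      repeat split; now apply (potential_path_integral U).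
    + apply isothermal_nondegenerate; auto.
      * now apply (potential_smooth U x phi1).
      * now apply (potential_smooth U y phi2).
      * now apply (potential_smooth U z phi3).
    + intros u v Huv. rewrite (trace_h_isothermal U) by auto.
      rewrite (potential_harmonic U z phi3) by auto. unfold Rdiv. ring.
    + intros u v Huv. repeat split; now apply (potential_phi_of U).
Qed.
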